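(* Let $G$ be a countable discrete amenable group, $X=\mathbb{N}^G$, and let $\phi\colon X\to\mathbb{R}$ be an exp-summable potential with summable variation according to an exhausting sequence $\{E_m\}_m$ of $G$. Then the set of $G$-invariant DLR measures for $\phi$ is non-empty.
   Context: $\mathbb{N}$ is the set of non-negative integers; $\mathcal{F}(G)$ is the set of nonempty finite subsets of $G$. $G$ is amenable if for all $K\in\mathcal{F}(G)$, $\delta>0$ there is $F\in\mathcal{F}(G)$ with $|KF\,\triangle\,F|<\delta|F|$. $X=\mathbb{N}^G$ has the product topology and Borel $\sigma$-algebra $\mathcal{B}$; for $D\subseteq G$, $\mathcal{B}_D$ is the $\sigma$-algebra generated by the coordinates in $D$. $x_D$ is the restriction of $x$ to $D$; for $w\in\mathbb{N}^K$, $wx_{K^c}$ is the configuration equal to $w$ on $K$ and to $x$ on $K^c=G\setminus K$. $G$ acts by $(g\cdot x)(h)=x(hg)$, and a measure $\mu$ is $G$-invariant if $\mu(g\cdot B)=\mu(B)$ for all $g\in G$, $B\in\mathcal{B}$. $\phi_F(x)=\sum_{g\in F}\phi(g\cdot x)$. An exhausting sequence is a sequence $\{E_m\}_{m\ge0}$ of finite subsets of $G$ with $E_0=\emptyset$, $E_1=\{1_G\}$, strictly increasing, with union $G$. With $\delta_E(\phi)=\sup\{|\phi(x)-\phi(y)|:x_E=y_E\}$, $\phi$ has summable variation according to $\{E_m\}_m$ if $\sum_{m\ge1}|E_{m+1}^{-1}\setminus E_m^{-1}|\,\delta_{E_m}(\phi)<\infty$. $\phi$ is exp-summable if $\sum_{a\in\mathbb{N}}\exp(\sup\{\phi(x):x(1_G)=a\})<\infty$.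 DLR measure: for $K\in\mathcal{F}(G)$, $B\in\mathcal{B}$, $x\in X$ let $$\gamma_K(B,x)=\lim_{m\to\infty}\frac{\sum_{w\in\mathbb{N}^K}\exp(\phi_{E_m}(wx_{K^c}))\mathbf{1}_{\{wx_{K^c}\in B\}}}{\sum_{v\in\mathbb{N}^K}\exp(\phi_{E_m}(vx_{K^c}))}$$ (the limit exists under the present hypotheses). A Borel probability measure $\mu$ on $X$ is a DLR measure for $\phi$ if $\mu(B\,|\,\mathcal{B}_{K^c})(x)=\gamma_K(B,x)$ for $\mu$-a.e. $x$, for every $K\in\mathcal{F}(G)$, $B\in\mathcal{B}$. *)

(* Defs.v *)
From HB Require Import structures.
From mathcomp Require Import all_boot all_order all_algebra finmap.
From mathcomp Require Import all_classical all_reals all_analysis.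

Set Implicit Arguments.
Unset Strict Implicit.
Unset Printing Implicit Defensive.

Import Order.TTheory GRing.Theory Num.Theory.
Import numFieldNormedType.Exports.

Local Open Scope fset_scope.
Local Open Scope classical_set_scope.
Local Open Scope ring_scope.

Section Groups.
Context {G : groupType}.

Definition fset_mulg (A B : {fset G}) : {fset G} :=
  [fset (a * b)%g | a in A, b in B].

Definition fset_invg (A : {fset G}) : {fset G} := [fset (a^-1)%g | a in A].

Definition fset_symdiff (A B : {fset G}) : {fset G} :=
  ((A `\` B) `|` (B `\` A))%fset.

Definition exhausting (E : nat -> {fset G}) : Prop :=
  [/\ E 0%N = fset0,
      E 1%N = [fset 1%g],
      forall m, (E m `<` E m.+1)%fset
    & forall g, exists m, g \in E m].

End Groups.

Definition amenable (R : realType) (G : groupType) : Prop :=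
  forall (K : {fset G}) (delta : R), K != fset0 -> 0 < delta ->
    exists F : {fset G}, F != fset0 /\
      #|` fset_symdiff (fset_mulg K F) F|%:R < delta * #|` F|%:R.

Definition config (G : groupType) := {ptws G -> nat}.

Definition borel_config (G : groupType) :=
  g_sigma_algebraType (@open (config G)).

Section Configurations.
Context {G : groupType}.

Definition config_act (g : G) (x : config G) : config G := fun h => x (h * g)%g.

(* The configuration written [w x_{K^c}]. *)
Definition config_glue (K : {fset G}) (w : {ffun K -> nat}) (x : config G) :
  config G := fun g => oapp w (x g) (insub g).

(* A generating family of the sigma-algebra of the coordinates in [D]. *)
Definition coord_system (D : set G) : set (set (config G)) :=
  \bigcup_(g in D)
    preimage_set_system setT (fun x : config G => x g) measurable.

End Configurations.

Section Potentials.
Context {R : realType} {G : groupType}.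
Implicit Type phi : config G -> R.

Definition phi_sum phi (F : {fset G}) (x : config G) : R :=
  \sum_(g <- F) phi (config_act g x).

Definition delta_sup phi (E : {fset G}) : \bar R :=
  ereal_sup [set r | exists x y : config G,
    (forall g, g \in E -> x g = y g) /\ r = `|phi x - phi y|%:E].

Definition summable_variation phi (E : nat -> {fset G}) : Prop :=
  (\sum_(1 <= m <oo)
     (#|` (fset_invg (E m.+1) `\` fset_invg (E m))%fset|%:R%:E
      * delta_sup phi (E m)) < +oo)%E.

Definition exp_summable phi : Prop :=
  (\sum_(0 <= a <oo)
     expeR (ereal_sup [set (phi x)%:E | x in [set x : config G | x 1%g = a]])
     < +oo)%E.

Definition gibbs_weight phi (F K : {fset G}) (B : set (config G))
    (x : config G) : \bar R :=
  \esum_(w in [set: {ffun K -> nat}])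
     (expR (phi_sum phi F (config_glue w x)) * \1_B (config_glue w x))%:E.

(* The two weights are finite as soon as [K] is contained in [E m]; for the
   finitely many other [m] the quotient may take a junk value, which does not
   affect the limit. *)
Definition dlr_kernel phi (E : nat -> {fset G}) (K : {fset G})
    (B : set (config G)) (x : config G) : R :=
  limn (fun m => fine (gibbs_weight phi (E m) K B x)
                 / fine (gibbs_weight phi (E m) K setT x)).

End Potentials.

(* [f] is a version of the conditional probability of [B] given the
   sigma-algebra generated by [S]. *)
Definition cond_prob_version d (T : measurableType d) (R : realType)
    (mu : probability T R) (S : set (set T)) (B : set T) (f : T -> R) : Prop :=
  [/\ measurable_fun setT (f : g_sigma_algebraType S -> R),
      mu.-integrable setT (EFin \o f)
    & forall A, <<s S >> A ->
        (\int[mu]_(x in A) (f x)%:E = mu (A `&` B))%E].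

Definition act_invariant (R : realType) (G : groupType)
    (mu : probability (borel_config G) R) : Prop :=
  forall (g : G) (B : set (borel_config G)), measurable B ->
    mu (config_act g @` B) = mu B.

Definition DLR_measure (R : realType) (G : groupType) (phi : config G -> R)
    (E : nat -> {fset G}) (mu : probability (borel_config G) R) : Prop :=
  forall (K : {fset G}) (B : set (borel_config G)), K != fset0 ->
    measurable B ->
    exists f : borel_config G -> R,
      cond_prob_version mu (coord_system (~` [set` K])) B f /\
      {ae mu, forall x, f x = dlr_kernel phi E K B x}.

(* Main.v *)
(* Let [eta_F] be the Gibbs distribution with energy [phi_F] on the configurations
   vanishing off the finite set [F]. Summable variation makes the conditional
   weights of [eta_F] on a finite set [K], given the configuration off [K], close to
   [gamma_K], uniformly in [w] and up to a factor [1 + e], as soon as [F] contains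
   a set [P(K, e)]; moreover [gamma_K] is, up to such a factor, a function of
   finitely many coordinates. Translating [eta_F] by [g] gives [eta_(F g^-1)], so the
   average of the translates of [eta_(E_n Phi_n)] over a Folner set [Phi_n] for [E_n]
   is almost invariant and almost DLR. Exp-summability bounds the one-site
   conditional distributions uniformly, hence these averages are tight.

   Their limit along an ultrafilter is a finitely additive content on all sets of
   configurations that is invariant, tight, and satisfies the approximate DLR
   inequalities on cylinders, which only involve finitely many values. Tightness
   makes it countably additive along each coordinate, so subdividing [[0, 1[]
   according to the cylinder masses yields a map into [nat^G] under which the image
   of Lebesgue measure has these masses. The DLR equation holds on cylinders off [K]
   by summing the inequalities over small cylinders, and then on the whole
   sigma-algebra of [K^c] by uniqueness of measures. *)

Require Import Defs.
From HB Require Import structures.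
From mathcomp Require Import all_boot all_order all_algebra finmap.
From mathcomp Require Import all_classical all_reals all_analysis.
From mathcomp Require Import measurable_realfun lra.

Set Implicit Arguments.
Unset Strict Implicit.
Unset Printing Implicit Defensive.

Import Order.TTheory GRing.Theory Num.Theory.
Import numFieldNormedType.Exports.

Local Open Scope fset_scope.
Local Open Scope classical_set_scope.
Local Open Scope ring_scope.

(** * Summable variation *)

Lemma sum_fset_split {V : nmodType} {T : choiceType} (P F : {fset T})
    (f : T -> V) : (P `<=` F)%fset ->
  \sum_(g <- F) f g = \sum_(g <- P) f g + \sum_(g <- (F `\` P)%fset) f g.
Proof.
move=> PF; rewrite (big_fsetID _ (mem P)) /=; congr (_ + _).
  apply: eq_fbigl => g; rewrite !inE /=; apply/andP/idP => [[]//|gP].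
  by split=> //; exact: (fsubsetP PF).
by apply: eq_fbigl => g; rewrite !inE andbC.
Qed.

Section ProductSets.
Context {G : groupType}.
Implicit Types A B K : {fset G}.

Lemma mem_fset_mulg A B a b : a \in A -> b \in B -> (a * b)%g \in fset_mulg A B.
Proof. by move=> aA bB; apply: in_imfset2. Qed.

Lemma fset_mulgP A B x :
  reflect (exists a b, [/\ a \in A, b \in B & x = (a * b)%g])
          (x \in fset_mulg A B).
Proof.
apply: (iffP (imfset2P _ _ _ _ _)) => /= [[a aA [b bB ->]]|[a [b [aA bB ->]]]].
  by exists a, b.
by exists a => //; exists b.
Qed.

Lemma mem_fset_invg A a : (a \in fset_invg A) = (a^-1%g \in A).
Proof.
apply/imfsetP/idP => [[b /= bA ->]|aA]; first by rewrite invgK.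
by exists a^-1%g => //=; rewrite invgK.
Qed.

Lemma card_fset_mulg A B : (#|` fset_mulg A B| <= #|` A| * #|` B|)%N.
Proof.
rewrite -(size_allpairs (fun a b : G => (a * b)%g)) uniq_leq_size ?fset_uniq//.
move=> x /fset_mulgP[a [b [aA bB ->]]].
by apply/allpairsP; exists (a, b).
Qed.

End ProductSets.

(** * Configurations agreeing on, or off, a finite set *)

Section EqOff.
Context {G : groupType}.
Implicit Types (K D F : {fset G}) (x y z : config G).

Definition eq_on D x y := forall g, g \in D -> x g = y g.
Definition eq_off K x y := forall g, g \notin K -> x g = y g.

Lemma eq_off_refl K x : eq_off K x x. Proof. by []. Qed.

Lemma eq_off_sym K x y : eq_off K x y -> eq_off K y x.
Proof. by move=> xy g /xy. Qed.

Lemma eq_off_trans K x y z : eq_off K x y -> eq_off K y z -> eq_off K x z.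
Proof. by move=> xy yz g gK; rewrite xy ?yz. Qed.

Lemma eq_off_sub K F x y : (K `<=` F)%fset -> eq_off K x y -> eq_off F x y.
Proof. by move=> /fsubsetP KF xy g gF; apply/xy/(contra _ gF)/KF. Qed.

(** At [h] the configuration [config_act g x] reads the coordinate [h g] of [x], so a site of [D]
    can see [K] only when [g] lies in [D^-1 K]. *)
Lemma eq_off_act D K x y g : eq_off K x y ->
  g \notin fset_mulg (fset_invg D) K ->
  eq_on D (config_act g x) (config_act g y) .
Proof.
move=> xy gDK h hD; apply: xy; apply: contra gDK => hgK.
by rewrite -[g](mulKg h); apply: mem_fset_mulg; rewrite // mem_fset_invg invgK.
Qed.

Lemma config_actM g h x : config_act g (config_act h x) = config_act (g * h)%g x.
Proof. by apply/funext => k; rewrite /config_act mulgA. Qed.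

Lemma config_act1 x : config_act 1%g x = x.
Proof. by apply/funext => k; rewrite /config_act mulg1. Qed.

End EqOff.

Section Exhausting.
Context {G : groupType} (E : nat -> {fset G}) (exhE : exhausting E).

Lemma exhausting_mono m n : (m <= n)%N -> (E m `<=` E n)%fset.
Proof.
move=> /subnK <-; elim: (n - m)%N => [|k IHk]; first exact: fsubset_refl.
by apply: (fsubset_trans IHk); case: exhE => _ _ /(_ (k + m)%N) /fproper_sub.
Qed.

Lemma exhausting_fset (F : {fset G}) : exists m, (F `<=` E m)%fset.
Proof.
have ex g : exists m, g \in E m by case: exhE.
elim/finSet_rect: F => F IH; case: (fset_0Vmem F) => [->|[g gF]].
  by exists 0%N; exact: fsub0set.
have [m Fm] := IH _ (fproperD1 gF); have [n gn] := ex g.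
exists (maxn m n); apply/fsubsetP => h hF; have [->|hg] := eqVneq h g.
  by apply: (fsubsetP (exhausting_mono _)) gn; rewrite leq_maxr.
apply: (fsubsetP (exhausting_mono (leq_maxl m n))).
by apply: (fsubsetP Fm); rewrite !inE hg.
Qed.

Lemma exhausting_near (F : {fset G}) : \forall m \near \oo, (F `<=` E m)%fset.
Proof.
have [m Fm] := exhausting_fset F; exists m => // n /= mn.
exact: fsubset_trans (exhausting_mono mn).
Qed.

Lemma exhausting1 m : (0 < m)%N -> 1%g \in E m.
Proof.
move=> m0; apply: (fsubsetP (exhausting_mono m0)).
by case: exhE => _ -> _ _; rewrite inE.
Qed.

Lemma fsubset_mulg_exhausting m (K : {fset G}) : (0 < m)%N ->
  (K `<=` fset_mulg (fset_invg (E m)) K)%fset.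
Proof.
move=> m0; apply/fsubsetP => g gK; rewrite -[g]mul1g mem_fset_mulg//.
by rewrite mem_fset_invg invg1 exhausting1.
Qed.

End Exhausting.

(** * Real bounds extracted from the variation series *)

Section Variation.
Context {R : realType} {G : groupType} (phi : config G -> R).
Context (E : nat -> {fset G}) (exhE : exhausting E).

Let c m : R := #|` (fset_invg (E m.+1) `\` fset_invg (E m))%fset|%:R.

(** Strict growth of [E] makes every shell nonempty. Hence each oscillation is at most its term in
    the variation series, and is therefore finite. *)
Let c_ge1 m : 1 <= c m.
Proof.
rewrite /c ler1n cardfs_gt0; apply/fset0Pn.
have [_ /fsubsetPn[g gS gm]] : (E m `<=` E m.+1)%fset /\ ~~ (E m.+1 `<=` E m)%fset.
  by case: exhE => _ _ /(_ m) + _ => /andP[].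
by exists g^-1%g; rewrite in_fsetD !mem_fset_invg !invgK gm gS.
Qed.

(** Replaces the extended-real series by real data: a modulus [d], a bound [V] on the partial sums,
    and arbitrarily small tails. The index 0 is excluded because [E 0] is empty: the total
    oscillation of [phi] may be infinite, and [fine] then returns 0. *)
Lemma summable_variation_real : summable_variation phi E ->
  exists d : nat -> R, exists V : R,
  [/\ forall m, 0 <= d m,
      forall m x y, (0 < m)%N -> eq_on (E m) x y -> `|phi x - phi y| <= d m,
      forall n, \sum_(1 <= k < n) c k * d k <= V &
      forall e, 0 < e -> exists2 m, (0 < m)%N &
        forall n, \sum_(m <= k < n) c k * d k <= e].
Proof.
move=> sv; pose d m := fine (delta_sup phi (E m)).
have dge0 m : (0 <= delta_sup phi (E m))%E.
  apply: ereal_sup_ubound; exists (fun=> 0%N), (fun=> 0%N); split => //.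
  by rewrite subrr normr0.
have tge0 m : (0 <= (c m)%:E * delta_sup phi (E m))%E.
  by rewrite mule_ge0// lee_fin (le_trans ler01 (c_ge1 m)).
have le_oo m n : (1 <= m)%N ->
    (\sum_(m <= k < n) (c k)%:E * delta_sup phi (E k) <=
     \sum_(1 <= k <oo) (c k)%:E * delta_sup phi (E k))%E.
  move=> m1; apply: le_trans (nneseries_lim_ge n _); last by move=> *; exact: tge0.
  case: (leqP m n) => mn; last by rewrite big_geq ?(ltnW mn)// sume_ge0.
  by rewrite [leRHS](big_cat_nat _ (n := m))//= leeDr// sume_ge0.
have dfin m : (0 < m)%N -> delta_sup phi (E m) \is a fin_num.
  move=> m0; rewrite ge0_fin_numE//; apply: le_lt_trans sv.
  apply: le_trans (le_oo m m.+1 m0); rewrite big_nat1.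
  by rewrite -[leLHS]mul1e lee_wpmul2r// lee_fin.
have sumE m n : (0 < m)%N -> (\sum_(m <= k < n) (c k)%:E * delta_sup phi (E k))%E
    = (\sum_(m <= k < n) c k * d k)%:E.
  move=> m0; rewrite -sumEFin; apply: eq_big_nat => k /andP[mk _].
  by rewrite EFinM fineK// dfin// (leq_trans m0).
set S := (\sum_(1 <= k <oo) (c k)%:E * delta_sup phi (E k))%E in le_oo sv.
have S0 : (0 <= S)%E by apply: nneseries_ge0 => *; exact: tge0.
have Sfin : S \is a fin_num by rewrite ge0_fin_numE.
have Vb n : \sum_(1 <= k < n) c k * d k <= fine S.
  by rewrite -lee_fin fineK// -sumE// le_oo.
have cd0 k : 0 <= c k * d k by rewrite mulr_ge0// ?fine_ge0// (le_trans ler01).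
exists d, (fine S); split => //.
- by move=> m; rewrite fine_ge0.
- move=> m x y m0 xy; rewrite -lee_fin /d fineK ?dfin//.
  by apply: ereal_sup_ubound; exists x, y.
- move=> e e0.
  pose u n := \sum_(1 <= k < n) c k * d k.
  have /sup_adherent : has_sup (range u).
    by split; [exists (u 0%N), 0%N|exists (fine S) => _ [n _ <-]; exact: Vb].
  (* The partial sum [u m] is within [e] of the supremum, so everything after it adds at most [e].
     Starting at [m.+1] keeps the index positive. *)
  move=> /(_ _ e0)[_ [m _ <-] um]; exists m.+1 => // n.
  have [mn|nm] := leqP m.+1 n; last by rewrite big_geq ?(ltnW nm)// ltW.
  have um1 : u m <= u m.+1.
    rewrite /u; case: m {um mn} => [|m]; first by rewrite !big_geq.
    by rewrite [leRHS]big_nat_recr//= lerDl.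
  have un : u n <= sup (range u).
    by apply: ub_le_sup; [exists (fine S) => _ [k _ <-]; exact: Vb|exists n].
  have : u n = u m.+1 + \sum_(m.+1 <= k < n) c k * d k.
    by rewrite /u [LHS](big_cat_nat _ (n := m.+1)).
  lra.
Qed.

(* An element [g] of [F] lies in some shell [E_(k+1)^-1 K \ E_k^-1 K] with [k >= m];
   such a shell has at most [#|K| c_k] elements, and there the summand is at most
   [d k] because [g x] and [g y] agree on [E_k]. *)
Lemma phi_sum_tail (d : nat -> R) (m : nat) (e : R) (K F : {fset G}) x y :
    (0 < m)%N -> (forall m, 0 <= d m) ->
    (forall m x y, (0 < m)%N -> eq_on (E m) x y -> `|phi x - phi y| <= d m) ->
    (forall n, \sum_(m <= k < n) c k * d k <= e) ->
    eq_off K x y ->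
    (forall g, g \in F -> g \notin fset_mulg (fset_invg (E m)) K) ->
  \sum_(g <- F) `|phi (config_act g x) - phi (config_act g y)| <=
    #|` K|%:R * e.
Proof.
move=> m0 d0 dP tail xy.
pose N k := fset_mulg (fset_invg (E k)) K.
have [K0|[k0 k0K]] := fset_0Vmem K.
  have -> : x = y by apply/funext => g; apply: xy; rewrite K0 inE.
  rewrite K0 cardfs0 mul0r => _; rewrite big1// => g _.
  by rewrite subrr normr0.
have e0 : 0 <= e by have := tail 0%N; rewrite big_geq.
suff H j : forall F, (F `<=` N (m + j)%N)%fset ->
    (forall g, g \in F -> g \notin N m) ->
    \sum_(g <- F) `|phi (config_act g x) - phi (config_act g y)| <=
    #|` K|%:R * \sum_(m <= k < m + j) c k * d k.
  (* Since [g = (k0 g^-1)^-1 k0], the set [F] lies in [E_j^-1 K] as soon as [E j] contains every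
     [k0 g^-1]. *)
  have [j Fj] := exhausting_fset exhE [fset k0 * g^-1 | g in F]%g.
  move=> Fm; apply: le_trans (H j F _ Fm) _; last by rewrite ler_wpM2l.
  apply/fsubsetP => g gF; rewrite -[g](mulgVK k0).
  rewrite mem_fset_mulg// mem_fset_invg invgM invgK.
  apply: (fsubsetP (exhausting_mono exhE (leq_addl m j))).
  by apply: (fsubsetP Fj); apply/imfsetP; exists g.
elim: j => [|j IHj] {}F FN Fm.
  rewrite addn0 in FN *; rewrite big_geq// mulr0 big_seq big1// => g gF.
  by have := Fm _ gF; rewrite (fsubsetP FN).
rewrite (big_fsetID _ (fun g => g \in N (m + j)%N)) /= addnS.
rewrite big_nat_recr ?leq_addr//= mulrDr lerD//.
  apply: IHj; first by apply/fsubsetP => g; rewrite !inE => /andP[].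
  by move=> g; rewrite !inE => /andP[/Fm].
set F' := [fset _ in _ | _]%fset.
have F'P g : g \in F' -> g \in F /\ g \notin N (m + j)%N.
  by rewrite /F' !inE => /andP[].
rewrite big_seq.
apply: (@le_trans _ _ (\sum_(g <- F' | g \in F') d (m + j)%N)).
  apply: ler_sum => g /F'P[gF gN]; apply: dP; first by rewrite addn_gt0 m0.
  exact: eq_off_act gN.
rewrite -big_seq big_const_seq count_predT iter_addr_0.
rewrite -[leLHS]mulr_natl mulrA ler_wpM2r// -natrM ler_nat.
apply: (leq_trans _ (n := #|` fset_mulg
   (fset_invg (E (m + j).+1) `\` fset_invg (E (m + j)))%fset K|)).
  apply: fsubset_leq_card; apply/fsubsetP => g /F'P[gF gN].
  have := fsubsetP FN _ gF; rewrite addnS => /fset_mulgP[a [b [aE bK gab]]].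
  rewrite gab mem_fset_mulg// in_fsetD aE andbT; apply: contra gN => aE'.
  by rewrite gab mem_fset_mulg.
by rewrite mulnC card_fset_mulg.
Qed.

End Variation.

Section Potential.
Context {R : realType} {G : groupType} (phi : config G -> R).
Context (E : nat -> {fset G}) (exhE : exhausting E).
Hypothesis var_phi : summable_variation phi E.

(** The case [m = 1] of [phi_sum_tail]: as [E 1] is the singleton of the identity, [E_1^-1 K] is [K]
    itself and the tail is the whole series, bounded by [V]. *)
Lemma phi_sum_tail_off : exists2 V : R, 0 <= V &
  forall (K F : {fset G}) x y, eq_off K x y -> (forall g, g \in F -> g \notin K) ->
  \sum_(g <- F) `|phi (config_act g x) - phi (config_act g y)| <=
    #|` K|%:R * V.
Proof.
have [d [V [d0 dP dV _]]] := summable_variation_real exhE var_phi.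
exists V => [|K F x y xy FK]; first by have := dV 0%N; rewrite big_geq.
apply: (phi_sum_tail exhE (m := 1) _ d0 dP dV xy) => // g /FK; apply: contra.
case/fset_mulgP => a [b [+ bK ->]]; rewrite mem_fset_invg.
by case: exhE => _ -> _ _; rewrite !inE invg_eq1 => /eqP ->; rewrite mul1g.
Qed.

(** The first term of the variation series controls [phi] on one-site cylinders. This keeps the
    suprema in exp-summability finite. *)
Lemma phi_cylinder_bound : exists2 d : R, 0 <= d &
  forall x y, x 1%g = y 1%g -> `|phi x - phi y| <= d.
Proof.
have [d [V [d0 dP dV _]]] := summable_variation_real exhE var_phi.
exists (d 1%N) => // x y xy; apply: dP => // g.
by case: exhE => _ -> _ _; rewrite inE => /eqP ->.
Qed.

(** Both energy differences are split at [P = E_m^-1 K]. Off [P] each of the two is at most [e / 4]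
    by the tail bound. On [P] the terms are paired as [x] with [x'] and [y] with [y']; agreement on
    [D = E_k P] makes each pairing cost at most [e / 4]. *)
Lemma phi_sum_compare (K : {fset G}) (e : R) : 0 < e ->
  exists P D : {fset G}, (K `<=` P)%fset /\
  forall (F F' : {fset G}) x y x' y', (P `<=` F)%fset -> (P `<=` F')%fset ->
    eq_off K x y -> eq_off K x' y' -> eq_on D x x' -> eq_on D y y' ->
  `|(phi_sum phi F x - phi_sum phi F y)
    - (phi_sum phi F' x' - phi_sum phi F' y')| <= e.
Proof.
move=> e0; have [d [V [d0 dP dV tl]]] := summable_variation_real exhE var_phi.
have e4 : 0 <= e / 4 by rewrite divr_ge0// ltW.
have K1 : 0 < #|` K|%:R + 1 :> R by rewrite ltr_wpDl.
have e1 : 0 < e / 4 / (#|` K|%:R + 1) by rewrite !divr_gt0.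
have [m m0 tlm] := tl _ e1.
pose P := fset_mulg (fset_invg (E m)) K.
have P1 : 0 < #|` P|%:R + 1 :> R by rewrite ltr_wpDl.
have e2 : 0 < e / 4 / (#|` P|%:R + 1) by rewrite !divr_gt0.
(* A tail cut after one term bounds [c k * d k]; the shell being nonempty, it bounds [d k] as
   well. *)
have [k k0 /(_ k.+1)] := tl _ e2; rewrite big_nat1 => dk.
have {}dk : d k <= e / 4 / (#|` P|%:R + 1).
  apply: le_trans dk; rewrite -[leLHS]mul1r ler_wpM2r// ler1n cardfs_gt0.
  have [_ /fsubsetPn[g gS gk]] :
      (E k `<=` E k.+1)%fset /\ ~~ (E k.+1 `<=` E k)%fset.
    by case: exhE => _ _ /(_ k) + _ => /andP[].
  by apply/fset0Pn; exists g^-1%g; rewrite in_fsetD !mem_fset_invg !invgK gk gS.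
exists P, (fset_mulg (E k) P); split; first exact: fsubset_mulg_exhausting.
move=> F F' x y x' y' PF PF' xy xy' xx yy.
have tailE (H : {fset G}) u v : (P `<=` H)%fset -> eq_off K u v ->
    `|\sum_(g <- (H `\` P)%fset)
        (phi (config_act g u) - phi (config_act g v))| <= e / 4.
  move=> PH uv; apply: (le_trans (ler_norm_sum _ _ _)).
  apply: (@le_trans _ _ (#|` K|%:R * (e / 4 / (#|` K|%:R + 1)))).
    apply: (phi_sum_tail exhE m0 d0 dP tlm uv) => g.
    by rewrite in_fsetD => /andP[].
  rewrite mulrCA -[leRHS]mulr1 ler_wpM2l//.
  by rewrite ler_pdivrMr// mul1r lerDl.
have coreE u v : eq_on (fset_mulg (E k) P) u v ->
    `|\sum_(g <- P) (phi (config_act g u) - phi (config_act g v))| <= e / 4.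
  move=> uv; apply: (le_trans (ler_norm_sum _ _ _)); rewrite big_seq.
  apply: (@le_trans _ _ (\sum_(g <- P | g \in P) (e / 4 / (#|` P|%:R + 1)))).
    apply: ler_sum => g gP; apply: le_trans dk; apply: dP => // h hE.
    by apply: uv; rewrite mem_fset_mulg.
  rewrite -big_seq big_const_seq count_predT iter_addr_0.
  rewrite -[leLHS]mulr_natl mulrCA -[leRHS]mulr1 ler_wpM2l//.
  by rewrite ler_pdivrMr// mul1r lerDl.
have splitE (H : {fset G}) u v : (P `<=` H)%fset ->
    phi_sum phi H u - phi_sum phi H v =
    \sum_(g <- P) (phi (config_act g u) - phi (config_act g v)) +
    \sum_(g <- (H `\` P)%fset) (phi (config_act g u) - phi (config_act g v)).
  by move=> PH; rewrite -sumrB (sum_fset_split _ PH).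
rewrite !splitE//.
have := tailE F x y PF xy; have := tailE F' x' y' PF' xy'.
have := coreE _ _ xx; have := coreE _ _ yy.
rewrite !sumrB !ler_norml; lra.
Qed.

Hypothesis exp_phi : exp_summable phi.

(** A change at the site [g] alters [phi_F] by the change of its term at [g], up to an error [V].
    For [y] this term is at most the supremum of [phi] over the cylinder of [y g], whose exponential
    is [z]. For [x] it is within [d] of the value of [phi] at the constant configuration [x g],
    which gives [C]. *)
Lemma one_site_bound : exists z C : nat -> R,
  [/\ forall a, 0 <= z a, (\sum_(0 <= a <oo) (z a)%:E < +oo)%E,
      forall b, 0 <= C b &
      forall (F : {fset G}) g x y, g \in F -> eq_off [fset g]%fset x y ->
      expR (phi_sum phi F y) <= C (x g) * z (y g) * expR (phi_sum phi F x)].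
Proof.
have [V V0 VP] := phi_sum_tail_off; have [d d0 dP] := phi_cylinder_bound.
pose S a : \bar R :=
  ereal_sup [set (phi x)%:E | x in [set x : config G | x 1%g = a]].
have S_ge x : ((phi x)%:E <= S (x 1%g))%E by apply: ereal_sup_ubound; exists x.
have S_le x : (S (x 1%g) <= (phi x + d)%:E)%E.
  apply: ge_ereal_sup => _ [y /= yx <-]; rewrite lee_fin.
  by have := dP _ _ yx; rewrite ler_norml; lra.
have S_fin a : S a \is a fin_num.
  have := S_ge (fun=> a); have := S_le (fun=> a); rewrite /=.
  by case: (S a).
exists (fun a => expR (fine (S a))), (fun b => expR (V + d - phi (fun=> b))).
split => //.
- rewrite (eq_eseriesr (g := fun a => expeR (S a))) //.
  by move=> a _; rewrite -[in RHS](fineK (S_fin a)).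
move=> F g x y gF xy; rewrite -!expRD ler_expR.
have gsF : ([fset g] `<=` F)%fset by rewrite fsub1set.
have : phi_sum phi F y - phi_sum phi F x <=
    phi (config_act g y) - phi (config_act g x) + V.
  rewrite /phi_sum -sumrB (sum_fset_split _ gsF) big_seq_fset1 lerD2l.
  apply: (le_trans (ler_norm _)); apply: (le_trans (ler_norm_sum _ _ _)).
  rewrite (_ : V = #|` [fset g]%fset|%:R * V); last by rewrite cardfs1 mul1r.
  apply: VP.
    exact: eq_off_sym.
  by move=> h; rewrite in_fsetD => /andP[].
have : phi (config_act g y) <= fine (S (y g)).
  rewrite -lee_fin fineK//; have := S_ge (config_act g y).
  by rewrite {2}/config_act mul1g.
have := dP (fun=> x g) (config_act g x); rewrite {1}/config_act mul1g.
by move=> /(_ erefl); rewrite ler_norml; lra.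
Qed.

End Potential.

(** * Finite-volume Gibbs distributions *)

Section EsumZ.
Context {R : realType} {T : choiceType}.

Lemma esumZl (I : set T) (c : R) (f : T -> \bar R) : 0 <= c ->
  (forall i, 0 <= f i)%E ->
  (\esum_(i in I) (c%:E * f i) = c%:E * \esum_(i in I) f i)%E.
Proof.
move=> c0 f0.
(* One inequality for every factor [k >= 0]; taking [k = c^-1] yields the reverse one. *)
have le_Zl k (h : T -> \bar R) : 0 <= k -> (forall i, 0 <= h i)%E ->
    (\esum_(i in I) (k%:E * h i) <= k%:E * \esum_(i in I) h i)%E.
  move=> k0 h0; apply: ge_ereal_sup => _ [X [finX XI] <-].
  rewrite -ge0_mule_fsumr// lee_wpmul2l ?lee_fin//.
  by apply: ereal_sup_ubound; exists X.
apply/eqP; rewrite eq_le le_Zl//=; have [->|cN0] := eqVneq c 0.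
  by rewrite mul0e esum_ge0// => i Ii; rewrite mul0e.
have cgt0 : 0 < c by rewrite lt_neqAle eq_sym cN0.
have := le_Zl c^-1 (fun i => c%:E * f i)%E; rewrite invr_ge0 => /(_ c0).
have cf0 i : (0 <= c%:E * f i)%E by rewrite mule_ge0.
move=> /(_ cf0); under eq_esum do rewrite muleA -EFinM mulVf// mul1e.
move=> le1; rewrite -(@lee_pmul2l _ c^-1%:E)//; last by rewrite lte_fin invr_gt0.
by rewrite muleA -EFinM mulVf// mul1e.
Qed.

End EsumZ.

(** * Patterns on a finite set, cylinders, and events off a finite set *)

Section Glue.
Context {G : groupType}.
Implicit Types (K : {fset G}) (x : config G).

Lemma config_glue_in K (w : {ffun K -> nat}) x (k : K) :
  config_glue w x (val k) = w k.
Proof. by rewrite /config_glue valK. Qed.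

Lemma config_glue_off K (w : {ffun K -> nat}) x g : g \notin K ->
  config_glue w x g = x g.
Proof. by move=> gK; rewrite /config_glue insubN. Qed.

Lemma eq_off_glue K (w : {ffun K -> nat}) x : eq_off K (config_glue w x) x.
Proof. by move=> g; exact: config_glue_off. Qed.

Lemma config_glue_res K x y : eq_off K y x ->
  config_glue [ffun k : K => y (val k)] x = y.
Proof.
move=> yx; apply/funext => g; have [gK|gK] := boolP (g \in K).
  by rewrite (config_glue_in _ _ [` gK]) ffunE.
by rewrite config_glue_off// yx.
Qed.

(** Turns sums over patterns on [K] into sums over the class of configurations equal to [x] off [K];
    such classes can be split without reindexing finite functions. *)
Lemma config_glue_bij K x :
  set_bij [set: {ffun K -> nat}] [set y | eq_off K y x]
    (fun w => config_glue w x).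
Proof.
split=> [w _|w w' _ _ ww'|y yx]; first exact: eq_off_glue.
  by apply/ffunP => k; rewrite -(config_glue_in w x) ww' config_glue_in.
by exists [ffun k : K => y (val k)] => //; exact: config_glue_res.
Qed.

Lemma config_glue_eq K (w : {ffun K -> nat}) x y : eq_off K x y ->
  config_glue w x = config_glue w y.
Proof.
move=> xy; apply/funext => g; rewrite /config_glue.
by case: insubP => //= gK; rewrite xy.
Qed.

(** One-site gluing indexed by [nat] instead of functions on a singleton, so that summing out a site
    gives a series over [nat]. *)
Definition config_upd (g : G) x (a : nat) : config G :=
  fun h => if h == g then a else x h.

Lemma config_upd_in g x a : config_upd g x a g = a.
Proof. by rewrite /config_upd eqxx. Qed.

Lemma config_upd_off g x a : eq_off [fset g]%fset (config_upd g x a) x.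
Proof. by move=> h; rewrite inE /config_upd => /negbTE ->. Qed.

Lemma config_upd_bij g x :
  set_bij [set: nat] [set y | eq_off [fset g]%fset y x] (config_upd g x).
Proof.
split=> [a _|a b _ _ /(congr1 (@^~ g))|y yx]; first exact: config_upd_off.
  by rewrite !config_upd_in.
exists (y g) => //; apply/funext => h; rewrite /config_upd.
by case: eqP => [->//|/eqP hg]; rewrite yx// inE.
Qed.

Definition cylinder K (w : {ffun K -> nat}) : set (config G) :=
  [set y | forall k : K, y (val k) = w k].

Lemma cylinder_glue K (w v : {ffun K -> nat}) x :
  cylinder w (config_glue v x) <-> v = w.
Proof.
split=> [wv|->]; last by move=> k; rewrite config_glue_in.
by apply/ffunP => k; rewrite -(wv k) config_glue_in.
Qed.

(** Dependence on the coordinates off [K] alone, stated for arbitrary sets without measurability. *)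
Definition insensitive K (A : set (config G)) :=
  forall x y, eq_off K x y -> A x -> A y.

Lemma insensitiveT K : insensitive K setT. Proof. by []. Qed.

End Glue.

Section EsumClass.
Context {R : realType} {G : groupType}.

(** Fubini for classes of configurations: each [y] has a unique intermediate [y0], equal to [x] on
    [K2] and to [y] off [K2]. Insensitivity lets membership in [A] be tested at [y0] instead of
    [y]. *)
Lemma esum_eq_off_split (K1 K2 : {fset G}) (A : set (config G))
    (f : config G -> \bar R) x :
  [disjoint K1 & K2]%fset -> insensitive K2 A -> (forall y, 0 <= f y)%E ->
  (\esum_(y in [set y | eq_off (K1 `|` K2)%fset y x] `&` A) f y =
   \esum_(y0 in [set y | eq_off K1 y x] `&` A)
      \esum_(y in [set y | eq_off K2 y y0]) f y)%E.
Proof.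
move=> /fdisjointP dK insA f0; rewrite esum_esum//.
apply: (reindex_esum _ _ (fun p : config G * config G => p.2)); split.
- move=> [y0 y] /= [[y0x Ay0] yy0]; split; last exact: insA (eq_off_sym yy0) Ay0.
  apply: eq_off_trans (eq_off_sub _ yy0) (eq_off_sub _ y0x).
    exact: fsubsetUr.
  exact: fsubsetUl.
- move=> [y0 y] [z0 z] /set_mem[/= [y0x _] yy0] /set_mem[/= [z0x _] zz0] yz.
  rewrite -yz in zz0 *; congr (_, _); apply/funext => g.
  have [gK|gK] := boolP (g \in K2); last by rewrite -yy0// -zz0.
  have gK1 : g \notin K1 by apply: contraL gK => /dK.
  by rewrite y0x// z0x.
- move=> y /= [yx Ay].
  pose y0 : config G := fun g => if g \in K2 then x g else y g.
  have y0y : eq_off K2 y y0 by move=> g gK; rewrite /y0 (negbTE gK).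
  exists (y0, y) => //=; split=> //; split; last exact: insA Ay.
  move=> g gK1; rewrite /y0; case: ifPn => // gK2.
  by rewrite yx// inE negb_or gK1.
Qed.

Lemma gibbs_weightE phi F (K : {fset G}) (B : set (config G)) x :
  gibbs_weight phi F K B x = \esum_(y in [set y | eq_off K y x])
    (expR (phi_sum phi F y) * \1_B y : R)%:E.
Proof. by rewrite (reindex_esum _ _ _ _ (config_glue_bij K x)). Qed.

End EsumClass.

Section RealEstimates.
Context {R : realType}.

Lemma le_addgt0_mulr (a b : R) : 0 <= b ->
  (forall e, 0 < e -> a <= (1 + e) * b) -> a <= b.
Proof.
move=> b0 ab; apply/ler_addgt0Pr => e e0.
have b1 : 0 < b + 1 by rewrite ltr_wpDl.
apply: (le_trans (ab (e / (b + 1)) _)); first by rewrite divr_gt0.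
rewrite mulrDl mul1r lerD2l mulrAC -[leRHS]mulr1 -mulrA ler_wpM2l ?(ltW e0)//.
by rewrite ler_pdivrMr// mul1r lerDl.
Qed.

Lemma le_factor_trans (a b : R) : 0 <= b ->
  (forall e, 0 < e -> exists2 q, a <= (1 + e) * q & q <= (1 + e) * b) -> a <= b.
Proof.
move=> b0 ab; apply: le_addgt0_mulr => // e e0.
(* With [d <= 1] and [d <= e / 3] one has [(1 + d)^2 <= 1 + 3 d <= 1 + e]. *)
pose d := Num.min (e / 3) 1; have d0 : 0 < d by rewrite lt_min divr_gt0/=.
have d1 : d <= 1 by rewrite ge_min lexx orbT.
have de : d <= e / 3 by rewrite ge_min lexx.
have [q aq qb] := ab _ d0.
apply: (@le_trans _ _ ((1 + d) * ((1 + d) * b))).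
  by apply: (le_trans aq); rewrite ler_wpM2l// addr_ge0// ltW.
by rewrite mulrA ler_wpM2r//; nra.
Qed.

Lemma dist_le_of_factor (a b e : R) : 0 <= e -> 0 <= a <= 1 -> 0 <= b <= 1 ->
  a <= (1 + e) * b -> b <= (1 + e) * a -> `|a - b| <= e.
Proof. by move=> e0 a01 b01 ab ba; rewrite ler_norml; nra. Qed.

Lemma dist_le_half (q a b e : R) :
  `|q - a| <= e / 2 -> `|q - b| <= e / 2 -> `|a - b| <= e.
Proof. by rewrite !ler_norml; lra. Qed.

End RealEstimates.

(** * Limits of bounded sequences along an ultrafilter *)

Section Ultralimit.
Context {R : realType}.

(* [L] is the limit along an ultrafilter; the inequality with three terms is all
   that is needed to transfer additivity, bounds and the DLR inequalities. *)
Lemma ultralimit : exists L : (nat -> R) -> R, forall (u v w : nat -> R) a b c d,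
  (forall n, 0 <= u n <= 1) -> (forall n, 0 <= v n <= 1) ->
  (forall n, 0 <= w n <= 1) ->
  (\forall n \near \oo, a * u n + b * v n + c * w n <= d) ->
  a * L u + b * L v + c * L w <= d.
Proof.
have [U [UU ooU]] := @ultraFilterLemma nat \oo _.
have UP : ProperFilter U by exact: ultra_proper.
have cvgU (u : nat -> R) : (forall n, 0 <= u n <= 1) -> cvg (u @ U).
  move=> u01.
  have [|p [_ clp]] := @segment_compact R 0 1 (u @ U) _.
    by apply: (@filterE nat U _ (u @^-1` `[0, 1])) => n /=; rewrite in_itv/= u01.
  apply/cvg_ex; exists p => V Vp.
  (* A cluster point of an ultrafilter is a limit: were the preimage of [V] not in [U], its
     complement would be, contradicting clustering. *)
  have [//|UV] := in_ultra_setVsetC (u @^-1` V) UU.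
  by have [x [/= ? ?]] := clp (~` V) V UV Vp.
exists (fun u => lim (u @ U)) => u v w a b c d u01 v01 w01 H.
have H1 : a * u n + b * v n + c * w n @[n --> U] -->
    a * lim (u @ U) + b * lim (v @ U) + c * lim (w @ U).
  apply: cvgD; first apply: cvgD.
  - by apply: cvgMl_tmp; exact: cvgU.
  - by apply: cvgMl_tmp; exact: cvgU.
  - by apply: cvgMl_tmp; exact: cvgU.
rewrite -(cvg_lim _ H1)//; apply: limr_le; first by apply/cvg_ex; eexists; exact: H1.
exact: ooU.
Qed.

End Ultralimit.

(** * Conditional distributions in finite volume and their limit *)

Section GibbsRatio.
Context {R : realType} {G : groupType} (phi : config G -> R).
Context (E : nat -> {fset G}) (exhE : exhausting E).
Hypothesis var_phi : summable_variation phi E.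
Hypothesis exp_phi : exp_summable phi.
Implicit Types (K F : {fset G}) (x y : config G) (A B : set (config G)).

Let weight_ge0 F B x : (0 <= (expR (phi_sum phi F x) * \1_B x : R)%:E)%E.
Proof. by rewrite lee_fin mulr_ge0// expR_ge0. Qed.

(* Induction on [K], summing out one site at a time with [one_site_bound]. *)
Lemma esum_weight_lty K F x : (K `<=` F)%fset ->
  (\esum_(y in [set y | eq_off K y x]) (expR (phi_sum phi F y))%:E < +oo)%E.
Proof.
have [z [C [z0 zoo C0 zC]]] := one_site_bound exhE var_phi exp_phi.
have eF0 F' y : (0 <= (expR (phi_sum phi F' y))%:E)%E by rewrite lee_fin expR_ge0.
elim/finSet_rect: K => K IH KF; have [->|[g gK]] := fset_0Vmem K.
  rewrite (_ : [set y | _] = [set x]) ?esum_set1 ?ltry//.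
  by apply/seteqP; split => [y /= yx|y ->//]; apply/funext => g; exact: yx.
have gF : g \in F by rewrite (fsubsetP KF).
have Kg : K = ((K `\ g) `|` [fset g])%fset by rewrite fsetUC fsetD1K.
have := @esum_eq_off_split R G (K `\ g)%fset [fset g]%fset setT
  (fun y => (expR (phi_sum phi F y))%:E) x.
rewrite !setIT -Kg => ->;
  [|by rewrite fdisjointX1 !inE eqxx|by []|by move=> y; exact: eF0].
have {}IH := IH _ (fproperD1 gK) (fsubset_trans (fsubD1set _ _) KF).
have zT0 : (0 <= \sum_(0 <= a <oo) (z a)%:E)%E.
  by apply: nneseries_ge0 => a _ _; rewrite lee_fin.
pose T := fine (\sum_(0 <= a <oo) (z a)%:E)%E.
have TE : (\sum_(0 <= a <oo) (z a)%:E = T%:E)%E by rewrite fineK// ge0_fin_numE.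
have T0 : 0 <= T by rewrite fine_ge0.
(* Summing out [g] costs the factor [C (x g) * T]. It does not depend on [y]: as [g] has been
   removed from [K], [y g = x g]. *)
apply: (@le_lt_trans _ _ (\esum_(y in [set y | eq_off (K `\ g)%fset y x])
    ((C (x g) * T)%:E * (expR (phi_sum phi F y))%:E))%E); last first.
  rewrite esumZl ?mulr_ge0//.
  by rewrite lte_mul_pinfty// lee_fin mulr_ge0.
apply: le_esum => y /= yx.
rewrite (reindex_esum _ _ _ _ (config_upd_bij g y)).
apply: (@le_trans _ _ (\esum_(a in [set: nat])
   ((C (x g) * expR (phi_sum phi F y))%:E * (z a)%:E)))%E.
  apply: le_esum => a _; rewrite -EFinM lee_fin.
  have := zC F g y (config_upd g y a) gF
    (eq_off_sym (@config_upd_off G g y a)).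
  rewrite config_upd_in yx ?mulrA 1?mulrAC// in_fsetD1 eqxx.
  by [].
rewrite esumZl//; last by rewrite mulr_ge0// expR_ge0.
by rewrite -nneseries_esumT// TE -!EFinM lee_fin mulrAC.
Qed.

Lemma gibbs_weight_ge0 F K B x : (0 <= gibbs_weight phi F K B x)%E.
Proof. by rewrite gibbs_weightE esum_ge0. Qed.

Lemma gibbs_weightT F K x : gibbs_weight phi F K setT x =
  \esum_(y in [set y | eq_off K y x]) (expR (phi_sum phi F y))%:E.
Proof. by rewrite gibbs_weightE; apply: eq_esum => y _; rewrite indicT mulr1. Qed.

Lemma le_gibbs_weightT F K B x :
  (gibbs_weight phi F K B x <= gibbs_weight phi F K setT x)%E.
Proof.
rewrite gibbs_weightT gibbs_weightE; apply: le_esum => y _.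
by rewrite lee_fin ler_piMr ?expR_ge0// indicE lern1 leq_b1.
Qed.

Lemma gibbs_weight_fin_num F K B x : (K `<=` F)%fset ->
  gibbs_weight phi F K B x \is a fin_num.
Proof.
move=> KF; rewrite ge0_fin_numE ?gibbs_weight_ge0//.
apply: le_lt_trans (le_gibbs_weightT F K B x) _.
by rewrite gibbs_weightT esum_weight_lty.
Qed.

Lemma gibbs_weightT_gt0 F K x : (K `<=` F)%fset ->
  0 < fine (gibbs_weight phi F K setT x).
Proof.
move=> KF; rewrite fine_gt0// -ge0_fin_numE ?gibbs_weight_ge0//.
rewrite gibbs_weight_fin_num// andbT gibbs_weightT.
apply: (@lt_le_trans _ _ (expR (phi_sum phi F x))%:E).
  by rewrite lte_fin expR_gt0.
apply: esum_ge; exists [set x]; last by rewrite fsbig_set1.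
by split=> // y ->; exact: eq_off_refl.
Qed.

Lemma gibbs_weightU F K A B x : [disjoint A & B] ->
  (gibbs_weight phi F K (A `|` B) x =
   gibbs_weight phi F K A x + gibbs_weight phi F K B x)%E.
Proof.
move=> dAB; rewrite !gibbs_weightE -esumD//; apply: eq_esum => y _.
rewrite -EFinD -mulrDr; congr (expR _ * _)%:E; rewrite !indicE in_setU.
have [yA|yA] := boolP (y \in A); have [yB|yB] := boolP (y \in B);
  rewrite ?addr0 ?add0r//.
by have := disj_setPS dAB; move=> /(_ y) []; split; exact/set_mem.
Qed.

(** For [K] inside [F], the conditional probability of [B] with energy [phi_F], given [x] off [K].
    With [F = E m] it is the sequence defining [dlr_kernel]; with [K = F] and [x = 0] it is the
    finite-volume Gibbs distribution. *)
Definition gibbs_ratio F K B x : R :=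
  fine (gibbs_weight phi F K B x) / fine (gibbs_weight phi F K setT x).

Lemma gibbs_ratio_ge0 F K B x : 0 <= gibbs_ratio F K B x.
Proof. by rewrite divr_ge0// fine_ge0// gibbs_weight_ge0. Qed.

Lemma gibbs_ratioT F K x : (K `<=` F)%fset -> gibbs_ratio F K setT x = 1.
Proof. by move=> KF; rewrite /gibbs_ratio divff// gt_eqF// gibbs_weightT_gt0. Qed.

Lemma gibbs_ratioU F K A B x : (K `<=` F)%fset -> [disjoint A & B] ->
  gibbs_ratio F K (A `|` B) x = gibbs_ratio F K A x + gibbs_ratio F K B x.
Proof.
move=> KF dAB; rewrite /gibbs_ratio gibbs_weightU//.
by rewrite fineD ?gibbs_weight_fin_num// mulrDl.
Qed.

Lemma gibbs_ratio_le1 F K B x : (K `<=` F)%fset -> gibbs_ratio F K B x <= 1.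
Proof.
move=> KF; rewrite /gibbs_ratio ler_pdivrMr ?gibbs_weightT_gt0// mul1r.
by rewrite fine_le ?gibbs_weight_fin_num// le_gibbs_weightT.
Qed.

(* The comparison is multiplicative and uniform in [w], so it passes from single
   configurations to arbitrary events and from finite volumes to the limit. *)
Lemma gibbs_ratio_compare K (e : R) : 0 < e ->
  exists P D : {fset G}, (K `<=` P)%fset /\
  forall F F' B B' x x', (P `<=` F)%fset -> (P `<=` F')%fset ->
    eq_on (D `\` K)%fset x x' ->
    (forall w : {ffun K -> nat}, B (config_glue w x) -> B' (config_glue w x')) ->
  gibbs_ratio F K B x <= (1 + e) * gibbs_ratio F' K B' x'.
Proof.
move=> e0; have l0 : 0 < ln (1 + e) / 2 by rewrite divr_gt0// ln_gt0// ltrDl.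
have [P [D [KP HP]]] := phi_sum_compare exhE var_phi K l0.
exists P, D; split => // F F' B B' x x' PF PF' xx' BB'.
have KF := fsubset_trans KP PF; have KF' := fsubset_trans KP PF'.
have glueD (w : {ffun K -> nat}) : eq_on D (config_glue w x) (config_glue w x').
  move=> g gD; rewrite /config_glue; case: insubP => //= gK.
  by apply: xx'; rewrite in_fsetD gK.
(* The reference pattern [w0] absorbs the energy difference [s] due to the change of volume and
   boundary. The factors [exp s] and [exp (- s)] cancel in the quotient; what remains is [exp l]
   once for the numerator and once for the denominator, in all [1 + e]. *)
pose w0 : {ffun K -> nat} := [ffun=> 0%N].
pose s := phi_sum phi F (config_glue w0 x) - phi_sum phi F' (config_glue w0 x').
set l := ln (1 + e) / 2 in l0 HP.
have glue_off (w : {ffun K -> nat}) y :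
    eq_off K (config_glue w y) (config_glue w0 y).
  exact: eq_off_trans (eq_off_glue _ _) (eq_off_sym (eq_off_glue _ _)).
have cmp (w : {ffun K -> nat}) : `|phi_sum phi F (config_glue w x) -
               phi_sum phi F' (config_glue w x') - s| <= l.
  have := HP F F' (config_glue w x) (config_glue w0 x) (config_glue w x')
    (config_glue w0 x') PF PF' (glue_off _ _) (glue_off _ _) (glueD _) (glueD _).
  by rewrite /s !ler_norml; lra.
have leB : fine (gibbs_weight phi F K B x) <=
    expR (s + l) * fine (gibbs_weight phi F' K B' x').
  rewrite -lee_fin EFinM !fineK ?gibbs_weight_fin_num// /gibbs_weight.
  rewrite -esumZl ?expR_ge0//; apply: le_esum => w _.
  rewrite -EFinM lee_fin mulrA -expRD ler_pM ?expR_ge0//.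
    by rewrite ler_expR; have := cmp w; rewrite ler_norml; lra.
  rewrite !indicE ler_nat; case: (boolP (_ \in B)) => // /set_mem /BB' ?.
  by rewrite mem_set.
have leT : fine (gibbs_weight phi F' K setT x') <=
    expR (l - s) * fine (gibbs_weight phi F K setT x).
  rewrite -lee_fin EFinM !fineK ?gibbs_weight_fin_num// /gibbs_weight.
  rewrite -esumZl ?expR_ge0//; apply: le_esum => w _.
  rewrite -EFinM lee_fin mulrA -expRD !indicT !mulr1.
  by rewrite ler_expR; have := cmp w; rewrite ler_norml; lra.
have e1E : 1 + e = expR (s + l) * expR (l - s).
  rewrite -expRD (_ : s + l + (l - s) = ln (1 + e)); last by rewrite /l; lra.
  by rewrite lnK// posrE addr_gt0.
rewrite /gibbs_ratio e1E ler_pdivrMr ?gibbs_weightT_gt0//.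
apply: (le_trans leB); rewrite -!mulrA ler_wpM2l ?expR_ge0//.
rewrite mulrCA ler_peMr ?fine_ge0 ?gibbs_weight_ge0//.
by rewrite mulrCA ler_pdivlMl ?gibbs_weightT_gt0// mulr1.
Qed.

(** Ratios lie in [[0, 1]], so comparability up to [1 + e / 2] places all those whose volume
    contains [P] within [e / 2] of each other: the sequence is Cauchy. *)
Lemma is_cvg_gibbs_ratio K B x : cvgn (fun m => gibbs_ratio (E m) K B x).
Proof.
apply: cauchy_cvg; apply: cauchy_exP => e e0.
have [P [D [KP HP]]] := gibbs_ratio_compare K (divr_gt0 e0 (ltr0Sn R 1)).
have [N PN] := exhausting_fset exhE P.
exists (gibbs_ratio (E N) K B x).
suff: \forall m \near \oo,
  ball (gibbs_ratio (E N) K B x) e (gibbs_ratio (E m) K B x) by [].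
near=> m.
have Pm : (P `<=` E m)%fset by near: m; exact: exhausting_near.
have b01 F : (P `<=` F)%fset -> 0 <= gibbs_ratio F K B x <= 1.
  by move=> PF; rewrite gibbs_ratio_ge0 gibbs_ratio_le1// (fsubset_trans KP).
rewrite /ball/= (@le_lt_trans _ _ (e / 2))//; last by lra.
by apply: dist_le_of_factor; rewrite ?b01 ?HP//; lra.
Unshelve. all: by end_near. Qed.

Lemma dlr_kernel_ge0 K B x : 0 <= dlr_kernel phi E K B x.
Proof.
apply: limr_ge; first exact: is_cvg_gibbs_ratio.
by apply: nearW => m; exact: gibbs_ratio_ge0.
Qed.

Lemma dlr_kernel_le1 K B x : dlr_kernel phi E K B x <= 1.
Proof.
apply: limr_le; first exact: is_cvg_gibbs_ratio.
near=> m; apply: gibbs_ratio_le1; near: m; exact: exhausting_near.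
Unshelve. all: by end_near. Qed.

Lemma dlr_kernel_compare K (e : R) : 0 < e ->
  exists P D : {fset G}, (K `<=` P)%fset /\
  forall F B B' x x', (P `<=` F)%fset -> eq_on (D `\` K)%fset x x' ->
    (forall w : {ffun K -> nat}, B (config_glue w x) <-> B' (config_glue w x')) ->
  gibbs_ratio F K B x <= (1 + e) * dlr_kernel phi E K B' x' /\
  dlr_kernel phi E K B' x' <= (1 + e) * gibbs_ratio F K B x.
Proof.
move=> e0; have [P [D [KP HP]]] := gibbs_ratio_compare K e0.
exists P, D; split=> // F B B' x x' PF xx' BB'.
have xx's : eq_on (D `\` K)%fset x' x by move=> g /xx'.
have e1 : 0 < 1 + e by rewrite addr_gt0.
split; last first.
  apply: limr_le; first exact: is_cvg_gibbs_ratio.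
  near=> m; apply: HP => //; last by move=> w /BB'.
  by near: m; exact: exhausting_near.
rewrite mulrC -ler_pdivrMr//; apply: limr_ge; first exact: is_cvg_gibbs_ratio.
near=> m; rewrite ler_pdivrMr// mulrC; apply: HP => //; last by move=> w /BB'.
by near: m; exact: exhausting_near.
Unshelve. all: by end_near. Qed.

Lemma dlr_kernel_approx K (e : R) : 0 < e ->
  exists P D : {fset G}, (K `<=` P)%fset /\
  forall F B B' x x', (P `<=` F)%fset -> eq_on (D `\` K)%fset x x' ->
    (forall w : {ffun K -> nat}, B (config_glue w x) <-> B' (config_glue w x')) ->
  `|gibbs_ratio F K B x - dlr_kernel phi E K B' x'| <= e.
Proof.
move=> e0; have [P [D [KP HP]]] := dlr_kernel_compare K e0.
exists P, D; split=> // F B B' x x' PF xx' BB'.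
have [? ?] := HP F B B' x x' PF xx' BB'.
apply: dist_le_of_factor => //; first exact: ltW.
  by rewrite gibbs_ratio_ge0 gibbs_ratio_le1// (fsubset_trans KP).
by rewrite dlr_kernel_ge0 dlr_kernel_le1.
Qed.

Lemma gibbs_ratio_esum F K B x : (K `<=` F)%fset ->
  ((gibbs_ratio F K B x)%:E = \esum_(w in [set: {ffun K -> nat}])
     (gibbs_ratio F K (cylinder w) x * \1_B (config_glue w x))%:E)%E.
Proof.
move=> KF; have T0 := gibbs_weightT_gt0 x KF.
have cylE (w : {ffun K -> nat}) : gibbs_ratio F K (cylinder w) x =
    expR (phi_sum phi F (config_glue w x)) /
    fine (gibbs_weight phi F K setT x).
  rewrite /gibbs_ratio {1}/gibbs_weight; congr (_ / _).
  rewrite -[RHS]/(fine (expR (phi_sum phi F (config_glue w x)))%:E).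
  congr fine.
  transitivity (\esum_(i in [set w])
      (expR (phi_sum phi F (config_glue i x)))%:E); last first.
    by rewrite esum_set1// lee_fin expR_ge0.
  rewrite [RHS]esum_mkcond; apply: eq_esum => v _.
  case: ifPn => [/set_mem -> | vw].
    by rewrite indicE mem_set ?mulr1//; exact/cylinder_glue.
  rewrite indicE memNset ?mulr0// => /cylinder_glue vwE.
  by move/negP: vw; apply; exact/mem_set.
rewrite {1}/gibbs_ratio EFinM muleC fineK ?gibbs_weight_fin_num//.
rewrite -esumZl ?invr_ge0 ?(ltW T0)//.
by apply: eq_esum => w _; rewrite cylE -EFinM mulrC mulrAC.
Qed.

(** The comparison between finite volume and limit uses the same volume for all [w], so it can be
    summed over [w]. Letting [e] tend to 0 exchanges limit and sum: no mass escapes. *)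
Lemma dlr_kernel_esum K B x :
  ((dlr_kernel phi E K B x)%:E = \esum_(w in [set: {ffun K -> nat}])
     (dlr_kernel phi E K (cylinder w) x * \1_B (config_glue w x))%:E)%E.
Proof.
set S := esum _ _.
have S0 : (0 <= S)%E.
  by apply: esum_ge0 => w _; rewrite lee_fin mulr_ge0// dlr_kernel_ge0.
have cmp e : 0 < e -> exists2 q, 0 <= q <= 1 &
    [/\ q <= (1 + e) * dlr_kernel phi E K B x,
     dlr_kernel phi E K B x <= (1 + e) * q,
     (q%:E <= (1 + e)%:E * S)%E & (S <= (1 + e)%:E * q%:E)%E].
  move=> e0; have [P [D [KP HP]]] := dlr_kernel_compare K e0.
  have e1 : 0 <= 1 + e by rewrite addr_ge0// ltW.
  exists (gibbs_ratio P K B x); first by rewrite gibbs_ratio_ge0 gibbs_ratio_le1.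
  have [? ?] := HP P B B x x (fsubset_refl P) (fun=> fun=> erefl) (fun=> iff_refl _).
  have cc (w : {ffun K -> nat}) :=
    HP P (cylinder w) (cylinder w) x x (fsubset_refl P) (fun=> fun=> erefl)
      (fun=> iff_refl _).
  split=> //; rewrite gibbs_ratio_esum// -esumZl//.
  - apply: le_esum => w _; rewrite -EFinM lee_fin mulrA ler_wpM2r//.
    by case: (cc w).
  - by move=> w; rewrite lee_fin mulr_ge0// dlr_kernel_ge0.
  - apply: le_esum => w _; rewrite -EFinM lee_fin mulrA ler_wpM2r//.
    by case: (cc w).
  - by move=> w; rewrite lee_fin mulr_ge0// gibbs_ratio_ge0.
have Sfin : S \is a fin_num.
  rewrite ge0_fin_numE//; have [q _ [_ _ _]] := cmp 1 ltr01.
  by move/le_lt_trans; apply; rewrite -EFinM ltry.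
rewrite -(fineK Sfin); congr _%:E; apply/eqP; rewrite eq_le; apply/andP; split.
  apply: le_factor_trans => [|e e0]; first exact: fine_ge0.
  have [q _ [_ q1 + _]] := cmp _ e0; rewrite -(fineK Sfin) -EFinM lee_fin.
  by exists q.
apply: le_factor_trans => [|e e0]; first exact: dlr_kernel_ge0.
have [q _ [q1 _ _ +]] := cmp _ e0; rewrite -(fineK Sfin) -EFinM lee_fin.
by exists q.
Qed.

(** The sum over patterns on [F] is taken first over [F \ K], which already decides [A], and then
    over [K], which gives the conditional weight. *)
Lemma gibbs_weight_decomp F K A B x : (K `<=` F)%fset -> insensitive K A ->
  (gibbs_weight phi F F (A `&` B) x =
   \esum_(y in [set y | eq_off (F `\` K)%fset y x] `&` A)
     gibbs_weight phi F K B y)%E.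
Proof.
move=> KF insA; rewrite gibbs_weightE.
transitivity (\esum_(y in [set y | eq_off F y x] `&` A)
    (expR (phi_sum phi F y) * \1_B y : R)%:E)%E.
  rewrite esum_mkcondr; apply: eq_esum => y _; rewrite !indicE in_setI.
  by case: (y \in A) => //=; rewrite mulr0.
have FE : F = ((F `\` K) `|` K)%fset.
  apply/fsetP => g; rewrite !inE; have [gK|] := boolP (g \in K).
    by rewrite (fsubsetP KF).
  by rewrite orbF.
rewrite [X in eq_off X]FE esum_eq_off_split//; last first.
  by apply/fdisjointP => g; rewrite in_fsetD => /andP[].
by apply: eq_esum => y _; rewrite gibbs_weightE.
Qed.

(** Total probability: the bound on the conditional probabilities is applied to each inner weight of
    [gibbs_weight_decomp] and then summed. *)
Lemma gibbs_ratio_le_cond F K A B x (c : R) : (K `<=` F)%fset ->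
  insensitive K A -> 0 <= c -> (forall y, A y -> gibbs_ratio F K B y <= c) ->
  gibbs_ratio F F (A `&` B) x <= c * gibbs_ratio F F A x.
Proof.
move=> KF insA c0 Bc; rewrite /gibbs_ratio mulrA ler_wpM2r//.
  by rewrite invr_ge0 fine_ge0// gibbs_weight_ge0.
rewrite -lee_fin EFinM !fineK ?gibbs_weight_fin_num// -{2}[A]setIT.
rewrite !(gibbs_weight_decomp _ _ KF insA) -esumZl//; last first.
  by move=> y; exact: gibbs_weight_ge0.
apply: le_esum => y [_ Ay].
rewrite -[leLHS]fineK ?gibbs_weight_fin_num//.
rewrite -[X in (_ * X)%E]fineK ?gibbs_weight_fin_num// -EFinM lee_fin.
by rewrite -ler_pdivrMr ?gibbs_weightT_gt0// Bc.
Qed.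

Lemma gibbs_ratio_ge_cond F K A B x (c : R) : (K `<=` F)%fset ->
  insensitive K A -> 0 <= c -> (forall y, A y -> c <= gibbs_ratio F K B y) ->
  c * gibbs_ratio F F A x <= gibbs_ratio F F (A `&` B) x.
Proof.
move=> KF insA c0 Bc; rewrite /gibbs_ratio mulrA ler_wpM2r//.
  by rewrite invr_ge0 fine_ge0// gibbs_weight_ge0.
rewrite -lee_fin EFinM !fineK ?gibbs_weight_fin_num// -{1}[A]setIT.
rewrite !(gibbs_weight_decomp _ _ KF insA) -esumZl//; last first.
  by move=> y; exact: gibbs_weight_ge0.
apply: le_esum => y [_ Ay].
rewrite -[leRHS]fineK ?gibbs_weight_fin_num//.
rewrite -[X in (_ * X)%E]fineK ?gibbs_weight_fin_num// -EFinM lee_fin.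
by rewrite -ler_pdivlMr ?gibbs_weightT_gt0// Bc.
Qed.

(** The normalising sum is at least the weight of [x0], the configuration with value 0 at [g]; by
    [one_site_bound] the numerator is at most this weight times [C 0] and a tail of the series of
    [z]. The resulting [t] is the same for all volumes, sites and boundary conditions. *)
Lemma gibbs_ratio_tight : exists2 t : nat -> R, t @ \oo --> 0 &
  forall F g x M, g \in F ->
    gibbs_ratio F [fset g]%fset [set y | (M <= y g)%N] x <= t M.
Proof.
have [z [C [z0 zoo C0 zC]]] := one_site_bound exhE var_phi exp_phi.
have tail0 M : (0 <= \sum_(M <= a <oo) (z a)%:E)%E.
  by apply: nneseries_ge0 => a _ _; rewrite lee_fin.
have tail_fin M : (\sum_(M <= a <oo) (z a)%:E)%E \is a fin_num.
  rewrite ge0_fin_numE//; apply: le_lt_trans zoo.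
  rewrite [leRHS](nneseries_split _ M) ?add0n ?leeDr//.
    by apply: sume_ge0 => a _; rewrite lee_fin.
  by move=> a _; rewrite lee_fin.
exists (fun M => C 0%N * fine (\sum_(M <= a <oo) (z a)%:E)%E).
  rewrite -(mulr0 (C 0%N)); apply: cvgMl_tmp.
  have z0' a : true -> (0 <= (z a)%:E)%E by rewrite lee_fin.
  exact: (fine_cvg (nneseries_tail_cvg zoo z0')).
move=> F g x M gF; have gsF : ([fset g] `<=` F)%fset by rewrite fsub1set.
pose x0 := config_upd g x 0%N.
have x0x : eq_off [fset g]%fset x0 x by exact: config_upd_off.
rewrite /gibbs_ratio ler_pdivrMr ?gibbs_weightT_gt0//.
apply: (@le_trans _ _ (C 0%N * fine (\sum_(M <= a <oo) (z a)%:E)%E *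
    expR (phi_sum phi F x0))); last first.
  rewrite ler_wpM2l ?mulr_ge0 ?fine_ge0//.
  rewrite -lee_fin fineK ?gibbs_weight_fin_num// gibbs_weightT.
  by apply: esum_ge; exists [set x0]; rewrite ?fsbig_set1//; split=> // y ->.
rewrite -lee_fin fineK ?gibbs_weight_fin_num// mulrAC EFinM fineK// gibbs_weightE.
rewrite (reindex_esum _ _ _ _ (config_upd_bij g x)).
have cz0 : 0 <= C 0%N * expR (phi_sum phi F x0) by rewrite mulr_ge0// expR_ge0.
apply: (@le_trans _ _ (\esum_(a in [set: nat])
    ((C 0%N * expR (phi_sum phi F x0))%:E *
    (if (M <= a)%N then (z a)%:E else 0)))%E).
  apply: le_esum => a _; rewrite indicE; case: ifPn => Ma.
    rewrite mem_set/= ?config_upd_in// mulr1 -EFinM lee_fin.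
    have := zC F g x0 (config_upd g x a) gF
      (eq_off_trans x0x (eq_off_sym (@config_upd_off G g x a))).
    by rewrite [x0 g]config_upd_in config_upd_in mulrAC.
  by rewrite memNset ?mulr0 ?mule0//= config_upd_in; exact/negP.
rewrite esumZl//; last by move=> a; case: ifP; rewrite ?lee_fin.
rewrite -nneseries_esumT; last by move=> a; case: ifP; rewrite ?lee_fin.
by rewrite -eseries_mkcond [X in (_ <= _ * X)%E]eseries_cond.
Qed.

(** Because [phi_F (y) = phi_(F g^-1) (g y)], and [g] maps the configurations vanishing off [F]
    bijectively onto those vanishing off [F g^-1]. *)
Lemma gibbs_ratio_shift F g B :
  gibbs_ratio F F [set x | B (config_act g x)] (fun=> 0%N) =
  gibbs_ratio [fset (h * g^-1)%g | h in F]%fset [fset (h * g^-1)%g | h in F]%fset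
    B (fun=> 0%N).
Proof.
set Fg := [fset _ | h in F]%fset.
have FgE h : ((h * g^-1)%g \in Fg) = (h \in F).
  apply/imfsetP/idP => [[k /= kF /mulIg->//]|hF]; by exists h.
have phiE y : phi_sum phi F y = phi_sum phi Fg (config_act g y).
  rewrite /phi_sum big_imfset /=; last by move=> h k _ _ /mulIg.
  by apply: eq_bigr => h _; rewrite config_actM mulgVK.
have bij : set_bij [set y | eq_off F y (fun=> 0%N)]
    [set y | eq_off Fg y (fun=> 0%N)] (config_act g).
  split=> [y /= yF h hFg|y y' _ _ yy'|y /= yF].
  - by rewrite /config_act yF// -FgE mulgK.
  - by rewrite -(config_act1 y) -(config_act1 y') -(mulVg g) -!config_actM yy'.
  - exists (config_act g^-1%g y); last by rewrite config_actM mulgV config_act1.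
    by move=> h hF; rewrite /config_act yF// FgE.
have wE B' : gibbs_weight phi F F [set x | B' (config_act g x)] (fun=> 0%N) =
    gibbs_weight phi Fg Fg B' (fun=> 0%N).
  rewrite !gibbs_weightE [RHS](reindex_esum _ _ _ _ bij); apply: eq_esum => y _.
  by rewrite phiE.
by rewrite /gibbs_ratio wE -(wE setT).
Qed.

(** * Averages of translates over Folner sets and their limiting content *)

Implicit Types (L Phi : {fset G}).

(* Law of a random [Phi]-translate of the finite-volume Gibbs measure on [L] with
   boundary condition [0]. *)
Definition averaged_gibbs L Phi B : R :=
  (\sum_(g <- Phi) gibbs_ratio L L [set x | B (config_act g x)] (fun=> 0%N))
  / #|` Phi|%:R.

Lemma averaged_gibbs_ge0 L Phi B : 0 <= averaged_gibbs L Phi B.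
Proof.
by rewrite divr_ge0// sumr_ge0// => g _; exact: gibbs_ratio_ge0.
Qed.

Lemma averaged_gibbsT L Phi : Phi != fset0 -> averaged_gibbs L Phi setT = 1.
Proof.
move=> Phi0; rewrite /averaged_gibbs (eq_bigr (fun=> 1)).
  rewrite big_const_seq count_predT iter_addr_0 divff//.
  by rewrite pnatr_eq0 cardfs_eq0.
by move=> g _; exact: gibbs_ratioT.
Qed.

Lemma averaged_gibbsU L Phi A B : [disjoint A & B] ->
  averaged_gibbs L Phi (A `|` B) = averaged_gibbs L Phi A + averaged_gibbs L Phi B.
Proof.
move=> dAB; rewrite /averaged_gibbs -mulrDl -big_split/=; congr (_ / _).
apply: eq_bigr => g _; rewrite -gibbs_ratioU//.
apply/disj_setPS => x [/= Ax Bx]; exact: (disj_setPS dAB (config_act g x)).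
Qed.

Lemma averaged_gibbs_le1 L Phi B : Phi != fset0 -> averaged_gibbs L Phi B <= 1.
Proof.
move=> Phi0; rewrite -(averaged_gibbsT L Phi0) -(setUv B) averaged_gibbsU.
  by rewrite lerDl averaged_gibbs_ge0.
by apply/disj_setPS; rewrite setICr.
Qed.

(** Acting by [h] turns the index set [Phi] into [h Phi]. The indices in [Phi] occur in the original
    sum; the others lie in [K Phi \ Phi], and each contributes at most 1. The reverse inequality is
    obtained in the limit from [h^-1]. *)
Lemma averaged_gibbs_invariant K L Phi B h (e : R) : h \in K -> Phi != fset0 ->
  #|` fset_symdiff (fset_mulg K Phi) Phi|%:R < e * #|` Phi|%:R ->
  averaged_gibbs L Phi [set x | B (config_act h x)] <= averaged_gibbs L Phi B + e.
Proof.
move=> hK Phi0 Folner.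
have P0 : 0 < #|` Phi|%:R :> R by rewrite ltr0n cardfs_gt0.
rewrite /averaged_gibbs ler_pdivrMr// mulrDl divfK ?gt_eqF//.
pose f g := gibbs_ratio L L [set x | B (config_act g x)] (fun=> 0%N).
have f01 g : 0 <= f g <= 1 by rewrite gibbs_ratio_ge0 gibbs_ratio_le1.
have -> : \sum_(g <- Phi) gibbs_ratio L L
      [set x | [set x | B (config_act h x)] (config_act g x)] (fun=> 0%N) =
    \sum_(g <- [fset (h * g)%g | g in Phi]%fset) f g.
  rewrite big_imfset/=; last by move=> ? ? _ _ /mulgI.
  apply: eq_bigr => g _; rewrite /f; congr (gibbs_ratio L L _ (fun=> 0%N)).
  by apply/seteqP; split=> x /=; rewrite config_actM.
rewrite (big_fsetID _ (mem Phi))/= lerD//.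
  rewrite [leRHS](sum_fset_split
    (P := [fset g in [fset (h * g)%g | g in Phi] | g \in Phi]%fset)).
    by rewrite lerDl sumr_ge0// => g _; case/andP: (f01 g).
  by apply/fsubsetP => g; rewrite !inE => /andP[].
apply: (le_trans _ (ltW Folner)).
set D := [fset _ in _ | _]%fset.
apply: (@le_trans _ _ (\sum_(g <- D) 1)).
  by apply: ler_sum => g _; case/andP: (f01 g).
rewrite big_const_seq count_predT iter_addr_0 ler_nat fsubset_leq_card//.
apply/fsubsetP => g; rewrite /D !inE => /andP[/imfsetP[k /= kP ->] hkP].
by rewrite hkP mem_fset_mulg.
Qed.

(** After translation every term of the average lives on a volume containing [P], so estimates valid
    for all such volumes apply term by term. *)
Lemma shifted_volume_sub P L Phi g : (fset_mulg P Phi `<=` L)%fset -> g \in Phi ->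
  (P `<=` [fset (h * g^-1)%g | h in L])%fset.
Proof.
move=> /fsubsetP PL gPhi; apply/fsubsetP => p pP; apply/imfsetP.
by exists (p * g)%g; rewrite /= ?mulgK// PL// mem_fset_mulg.
Qed.

Lemma averaged_gibbs_le_cond P K L Phi A B (c : R) :
  (K `<=` P)%fset -> (fset_mulg P Phi `<=` L)%fset -> insensitive K A -> 0 <= c ->
  (forall F y, (P `<=` F)%fset -> A y -> gibbs_ratio F K B y <= c) ->
  averaged_gibbs L Phi (A `&` B) <= c * averaged_gibbs L Phi A.
Proof.
move=> KP PL insA c0 Bc; rewrite /averaged_gibbs mulrA ler_wpM2r// mulr_sumr.
rewrite [leLHS]big_seq [leRHS]big_seq; apply: ler_sum => g gPhi.
have PF := shifted_volume_sub PL gPhi.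
rewrite !gibbs_ratio_shift; apply: (gibbs_ratio_le_cond _ _ insA c0).
  exact: fsubset_trans PF.
by move=> y; exact: Bc.
Qed.

Lemma averaged_gibbs_ge_cond P K L Phi A B (c : R) :
  (K `<=` P)%fset -> (fset_mulg P Phi `<=` L)%fset -> insensitive K A -> 0 <= c ->
  (forall F y, (P `<=` F)%fset -> A y -> c <= gibbs_ratio F K B y) ->
  c * averaged_gibbs L Phi A <= averaged_gibbs L Phi (A `&` B).
Proof.
move=> KP PL insA c0 Bc; rewrite /averaged_gibbs mulrA ler_wpM2r// mulr_sumr.
rewrite [leLHS]big_seq [leRHS]big_seq; apply: ler_sum => g gPhi.
have PF := shifted_volume_sub PL gPhi.
rewrite !gibbs_ratio_shift; apply: (gibbs_ratio_ge_cond _ _ insA c0).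
  exact: fsubset_trans PF.
by move=> y; exact: Bc.
Qed.

Definition content (m : set (config G) -> R) := [/\ forall B, 0 <= m B,
  m setT = 1 & forall A B, [disjoint A & B] -> m (A `|` B) = m A + m B].

(** A form of the DLR equation that passes to ultralimits: on an event fixing the coordinates in
    [D \ K] the kernel is almost constant, hence evaluated at one reference point [x0]. The error is
    proportional to [m A], so that it can be summed over disjoint events. *)
Definition approx_dlr (m : set (config G) -> R) := forall K (e : R), 0 < e ->
  exists D : {fset G}, forall A x0 (w : {ffun K -> nat}), insensitive K A ->
    (forall x, A x -> eq_on (D `\` K)%fset x x0) ->
  `|m (A `&` cylinder w) - dlr_kernel phi E K (cylinder w) x0 * m A| <= e * m A.

Lemma exists_limit_content : amenable R G ->
  exists (m : set (config G) -> R) (t : nat -> R),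
  [/\ content m, t @ \oo --> 0, forall g M, m [set x | (M <= x g)%N] <= t M,
      forall h B, m [set x | B (config_act h x)] = m B & approx_dlr m].
Proof.
move=> amen; have [L LP] := @ultralimit R.
have [t t0 tight] := gibbs_ratio_tight.
(* [E n.+1] instead of [E n], since [E 0] is empty and amenability concerns nonempty sets. *)
have /choice[Phi PhiP] n : exists Phi : {fset G}, Phi != fset0 /\
    #|` fset_symdiff (fset_mulg (E n.+1) Phi) Phi|%:R <
      n.+1%:R^-1 * #|` Phi|%:R :> R.
  apply: amen; last by rewrite invr_gt0.
  by apply/fset0Pn; exists 1%g; exact: exhausting1.
have Phi0 n : Phi n != fset0 by case: (PhiP n).
pose nu n B := averaged_gibbs (fset_mulg (E n.+1) (Phi n)) (Phi n) B.
have nu01 B n : 0 <= nu n B <= 1.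
  by rewrite averaged_gibbs_ge0 averaged_gibbs_le1.
have volP P : \forall n \near \oo,
    (fset_mulg P (Phi n) `<=` fset_mulg (E n.+1) (Phi n))%fset.
  near=> n; have PE : (P `<=` E n)%fset by near: n; exact: exhausting_near.
  apply/fsubsetP => _ /fset_mulgP[a [b [aP bPhi ->]]]; rewrite mem_fset_mulg//.
  by apply: (fsubsetP (exhausting_mono exhE (leqnSn n))); exact: (fsubsetP PE).
pose m B := L (nu ^~ B).
have mlin a b c d A B C :
    (\forall n \near \oo, a * nu n A + b * nu n B + c * nu n C <= d) ->
    a * m A + b * m B + c * m C <= d.
  by move=> H; apply: LP => // n; exact: nu01.
have m_ge0 B : 0 <= m B.
  have := mlin (-1) 0 0 0 B B B; rewrite !mul0r !addr0 mulN1r oppr_le0; apply.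
  apply: nearW => n; rewrite !mul0r !addr0 mulN1r oppr_le0.
  by case/andP: (nu01 B n).
have m_le1 B : m B <= 1.
  have := mlin 1 0 0 1 B B B; rewrite !mul0r !addr0 mul1r; apply.
  apply: nearW => n; rewrite !mul0r !addr0 mul1r.
  by case/andP: (nu01 B n).
have mT : m setT = 1.
  apply/eqP; rewrite eq_le m_le1/=.
  have := mlin (-1) 0 0 (-1) setT setT setT.
  rewrite !mul0r !addr0 mulN1r lerN2; apply; apply: nearW => n.
  by rewrite !mul0r !addr0 mulN1r lerN2 /nu averaged_gibbsT.
have mU A B : [disjoint A & B] -> m (A `|` B) = m A + m B.
  move=> dAB; have nuU n : nu n (A `|` B) = nu n A + nu n B.
    exact: averaged_gibbsU.
  have := mlin 1 (-1) (-1) 0 (A `|` B) A B; have := mlin (-1) 1 1 0 (A `|` B) A B.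
  have H1 : \forall n \near \oo, 1 * nu n (A `|` B) + -1 * nu n A + -1 * nu n B <= 0.
    by apply: nearW => n; rewrite nuU; lra.
  have H2 : \forall n \near \oo, -1 * nu n (A `|` B) + 1 * nu n A + 1 * nu n B <= 0.
    by apply: nearW => n; rewrite nuU; lra.
  by move=> /(_ H2) + /(_ H1); lra.
exists m, t; split => //.
- move=> g M; pose B : set (config G) := [set x | (M <= x g)%N].
  have := mlin 1 0 0 (t M) B B B; rewrite !mul0r !addr0 mul1r; apply.
  near=> n; rewrite !mul0r !addr0 mul1r.
  have t_ge0 : 0 <= t M.
    apply: (le_trans _ (tight [fset g]%fset g (fun=> 0%N) M _)).
      exact: gibbs_ratio_ge0.
    by rewrite inE.
  (* The one-site bound is a conditional bound with [K = P = {g}] and the trivial conditioning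
     event. *)
  have := @averaged_gibbs_le_cond [fset g]%fset [fset g]%fset
    (fset_mulg (E n.+1) (Phi n)) (Phi n) setT B (t M) (fsubset_refl _) _
    (@insensitiveT _ _) t_ge0.
  rewrite setTI averaged_gibbsT ?mulr1//; apply; first by near: n; exact: volP.
  by move=> F y gF _; apply: tight; rewrite -fsub1set.
- have half h B : m [set x | B (config_act h x)] <= m B.
    apply/ler_addgt0Pr => e e0.
    have := mlin 1 (-1) 0 e [set x | B (config_act h x)] B B.
    rewrite mul0r addr0 mul1r mulN1r lerBlDl; apply.
    near=> n; rewrite mul0r addr0 mul1r mulN1r lerBlDl.
    apply: (@le_trans _ _ (nu n B + n.+1%:R^-1)).
      apply: (averaged_gibbs_invariant (K := E n.+1)) => //; last by case: (PhiP n).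
      have : ([fset h] `<=` E n)%fset by near: n; exact: exhausting_near.
      rewrite fsub1set => hE.
      exact: (fsubsetP (exhausting_mono exhE (leqnSn n))).
    rewrite lerD2l ltW//; near: n; exact: near_infty_natSinv_lt (PosNum e0).
  (* The other inequality is [half] for [h^-1], applied to the translated event. *)
  move=> h B; apply/eqP; rewrite eq_le half/=.
  have := half h^-1%g [set x | B (config_act h x)].
  rewrite (_ : [set x | _] = B)//; apply/seteqP.
  by split=> x /=; rewrite config_actM mulgV config_act1.
- move=> K e e0; have [P [D [KP HP]]] := dlr_kernel_approx K e0.
  exists D => A x0 w insA AD; set c := dlr_kernel _ _ _ _ _.
  have qc F y : (P `<=` F)%fset -> A y -> `|gibbs_ratio F K (cylinder w) y - c| <= e.
    by move=> PF Ay; apply: HP => //; [exact: AD|move=> v; rewrite !cylinder_glue].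
  have c0 : 0 <= c by exact: dlr_kernel_ge0.
  rewrite ler_norml; apply/andP; split.
    (* The lower conditional estimate requires a nonnegative constant [c - e]. If [c < e], the claim
       follows from the positivity of [m]. *)
    have [ce|ce] := leP e c; last first.
      apply: (@le_trans _ _ (- (c * m A))).
        by rewrite lerN2 ler_wpM2r// ltW.
      by rewrite lerBrDl subrr.
    have := mlin (c - e) (-1) 0 0 A (A `&` cylinder w) A.
    have H : \forall n \near \oo,
        (c - e) * nu n A + -1 * nu n (A `&` cylinder w) + 0 * nu n A <= 0.
      near=> n; rewrite mul0r addr0 mulN1r subr_le0.
      apply: (averaged_gibbs_ge_cond KP _ insA); rewrite ?subr_ge0//.
        by near: n; exact: volP.
      by move=> F y PF Ay; have := qc F y PF Ay; rewrite ler_norml; lra.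
    by move=> /(_ H); lra.
  have := mlin (- (c + e)) 1 0 0 A (A `&` cylinder w) A.
  have H : \forall n \near \oo,
      - (c + e) * nu n A + 1 * nu n (A `&` cylinder w) + 0 * nu n A <= 0.
    near=> n; rewrite mul0r addr0 mul1r mulNr addrC subr_le0.
    apply: (averaged_gibbs_le_cond KP _ insA); rewrite ?addr_ge0// ?ltW//.
      by near: n; exact: volP.
    by move=> F y PF Ay; have := qc F y PF Ay; rewrite ler_norml; lra.
  by move=> /(_ H); lra.
Unshelve. all: by end_near. Qed.

End GibbsRatio.

(** * Borel sets of configurations *)

Section CountableSums.
Context {R : realType} (I : countType).

(** Enumeration by codes; a number that codes no element contributes 0. *)
Lemma esum_countType (a : I -> \bar R) : (forall i, 0 <= a i)%E ->
  (\esum_(i in [set: I]) a i = \sum_(n <oo) oapp a 0 (pickle_inv n))%E.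
Proof.
move=> a0; have b0 n : (0 <= oapp a 0 (@pickle_inv I n))%E.
  by case: (pickle_inv n).
rewrite nneseries_esumT//.
transitivity (\esum_(n in range (@choice.pickle I)) oapp a 0%E (pickle_inv n)).
  rewrite esum_image; last by move=> i k _ _; exact: (pcan_inj choice.pickleK).
  by apply: eq_esum => i _; rewrite pickleK_inv.
rewrite esum_mkcond; apply: eq_esum => n _; case: ifPn => // /negP nr.
have := @pickle_invK I n; case: (pickle_inv n) => //= i iE.
by exfalso; apply: nr; rewrite inE; exists i.
Qed.

Lemma measure_bigcup_esum d (T : measurableType d) (mu : {measure set T -> \bar R})
    (F : I -> set T) : (forall i, measurable (F i)) -> trivIset setT F ->
  (mu (\bigcup_i F i) = \esum_(i in [set: I]) mu (F i))%E.
Proof.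
move=> mF tF; rewrite esum_countType//.
pose H n := oapp F set0 (@pickle_inv I n).
have -> : \bigcup_i F i = \bigcup_n H n.
  apply/seteqP; split=> [x [i _ Fix]|x [n _]]; rewrite /H.
    by exists (choice.pickle i) => //; rewrite pickleK_inv.
  by case: (pickle_inv n) => //= i Fix; exists i.
rewrite measure_bigcup.
- rewrite (eq_eseriesl (Q := xpredT)); last by move=> n; rewrite in_setT.
  by apply: eq_eseriesr => n _; rewrite /H; case: (pickle_inv n) => //=.
- by move=> n _; rewrite /H; case: (pickle_inv n) => //=.
- move=> n k _ _ [x []]; rewrite /H.
  have := @pickle_invK I n; have := @pickle_invK I k.
  case: (pickle_inv n) => //= i; case: (pickle_inv k) => //= l <- <- Fix Flx.
  by congr choice.pickle; apply: tF => //; exists x.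
Qed.

End CountableSums.

Section BorelConfig.
Context {G : groupType} (E : nat -> {fset G}) (exhE : exhausting E).
Implicit Types (D : {fset G}) (S : set G) (A : set (config G)).

Definition local_set D A := forall x y, eq_on D x y -> A x -> A y.

Lemma cylinder_res D x : cylinder [ffun k : D => x (val k)] x.
Proof. by move=> k; rewrite ffunE. Qed.

Lemma cylinder_eq_on D (w : {ffun D -> nat}) x y : cylinder w x -> cylinder w y ->
  eq_on D x y.
Proof. by move=> xw yw g gD; rewrite (xw [` gD]) (yw [` gD]). Qed.

Lemma local_cylinder D (w : {ffun D -> nat}) : local_set D (cylinder w).
Proof. by move=> x y xy xw k; rewrite -xy ?xw// (valP k). Qed.

Lemma trivIset_cylinder D : trivIset setT (@cylinder G D).
Proof.
move=> v w _ _ [x [xv xw]]; apply/ffunP => k; by rewrite -xv -xw.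
Qed.

Lemma local_setC D A : local_set D A -> local_set D (~` A).
Proof. by move=> lA x y xy + Ay; apply; apply: lA Ay => g /xy. Qed.

Lemma local_setI D A A' : local_set D A -> local_set D A' -> local_set D (A `&` A').
Proof. by move=> lA lA' x y xy [? ?]; split; [exact: lA xy _|exact: lA' xy _]. Qed.

Lemma local_set_sub D D' A : (D `<=` D')%fset -> local_set D A -> local_set D' A.
Proof.
by move=> /fsubsetP DD' lA x y xy; apply: lA => g /DD'; exact: xy.
Qed.

(** There are countably many patterns on a finite [D], so this writes a local set as a countable
    union of cylinders and makes it measurable. Patterns whose cylinder is not inside [A] contribute
    the empty set. *)
Lemma local_set_bigcup D A : local_set D A ->
  A = \bigcup_(w : {ffun D -> nat})
        (if `[< cylinder w `<=` A >] then cylinder w else set0).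
Proof.
move=> lA; apply/seteqP; split=> [x Ax|x [w _]]; last first.
  by case: asboolP => // sub /sub.
exists [ffun k : D => x (val k)] => //; case: asboolP => [_|].
  exact: cylinder_res.
case=> y yw; apply: lA Ax; exact: cylinder_eq_on (cylinder_res _) yw.
Qed.

Lemma coord_measurable S g (Y : set nat) : S g ->
  <<s coord_system S >> [set x : config G | Y (x g)].
Proof.
move=> Sg; apply: sub_sigma_algebra; exists g => //.
by exists Y => //; rewrite setTI.
Qed.

Lemma cylinder_measurable S D (w : {ffun D -> nat}) : (forall g, g \in D -> S g) ->
  <<s coord_system S >> (cylinder w).
Proof.
move=> DS; rewrite (_ : cylinder w =
    \bigcap_(k in [set: D]) [set x : config G | x (val k) = w k]).
  apply: (@fin_bigcap_measurable _ (g_sigma_algebraType (coord_system S))).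
    exact: finite_finset.
  move=> k _; apply: (@coord_measurable S (val k) [set w k]).
  by apply: DS; exact: valP.
by apply/seteqP; split=> x xw k => [_|]; exact: xw.
Qed.

Lemma local_set_measurable S D A : (forall g, g \in D -> S g) -> local_set D A ->
  <<s coord_system S >> A.
Proof.
move=> DS /local_set_bigcup ->.
apply: (@countable_bigcupT_measurable _
  (g_sigma_algebraType (coord_system S))) => //.
by move=> w; case: asboolP => _; [exact: cylinder_measurable|exact: measurable0].
Qed.

(** Otherwise there would be, for each [n], a configuration outside [U] agreeing with [x] on [E n];
    these converge to [x] coordinatewise, against openness. *)
Lemma open_local (U : set (config G)) x : open U -> U x ->
  exists n, forall y, eq_on (E n) y x -> U y.
Proof.
move=> oU Ux; apply: contrapT => /forallNP H.
have /choice[y yP] n : exists y, eq_on (E n) y x /\ ~ U y.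
  by have /existsNP[y /not_implyP[? ?]] := H n; exists y.
have yx : y n @[n --> \oo] --> x.
  apply/cvg_sup => g A [/= _ [[W oW <-] Wx WA]].
  apply: (@filterS _ _ _ _ _ WA).
  have : \forall n \near \oo, ([fset g] `<=` E n)%fset by exact: exhausting_near.
  apply: filterS => n; rewrite fsub1set => gE.
  by have [yx _] := yP n; rewrite /preimage/= yx.
have : nbhs x U by exact: open_nbhs_nbhs.
move=> /yx [n _ /(_ n (leqnn n))] /=; by case: (yP n).
Qed.

(** By [open_local] an open set is the union of the cylinders over the sets [E n] that it contains,
    and these are countably many. Conversely, coordinates are continuous into a discrete space. *)
Lemma measurable_borel_config :
  @measurable _ (borel_config G) = <<s coord_system setT >>.
Proof.
apply/seteqP; split; apply: smallest_sub; try exact: smallest_sigma_algebra.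
- move=> U oU.
  pose F (i : {n : nat & {ffun E n -> nat}}) :=
    if `[< cylinder (tagged i) `<=` U >] then cylinder (tagged i) else set0.
  rewrite (_ : U = \bigcup_i F i).
    apply: (@countable_bigcupT_measurable _
      (g_sigma_algebraType (coord_system setT))).
      exact: (@countableP {n : nat & {ffun E n -> nat}}).
    move=> i; rewrite /F; case: asboolP => _; last exact: measurable0.
    exact: cylinder_measurable.
  apply/seteqP; split=> [x Ux|x [i _]]; last first.
    by rewrite /F; case: asboolP => // sub /sub.
  have [n nU] := open_local oU Ux.
  exists (Tagged (fun n => {ffun E n -> nat}) [ffun k : E n => x (val k)]) => //.
  rewrite /F; case: asboolP => [_|]; first exact: cylinder_res.
  by case=> y yw; apply: nU; exact: cylinder_eq_on yw (cylinder_res _).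
- move=> A [g _ [Y _ <-]]; rewrite setTI; apply: sub_sigma_algebra.
  apply: open_comp; last exact: discrete_open.
  by move=> x _; exact: (@proj_continuous G (fun=> nat) g).
Qed.

Lemma local_set_borel D A : local_set D A -> measurable (A : set (borel_config G)).
Proof.
by move=> lA; rewrite measurable_borel_config; exact: local_set_measurable lA.
Qed.

(** A generating family that, unlike [coord_system], is closed under intersection, as uniqueness of
    measures requires. *)
Definition local_sets S : set (set (config G)) :=
  [set A | exists2 D : {fset G}, (forall g, g \in D -> S g) & local_set D A].

Lemma coord_local_sets S : <<s coord_system S >> = <<s local_sets S >>.
Proof.
apply/seteqP; split; apply: smallest_sub; try exact: smallest_sigma_algebra.
  move=> _ [g Sg [Y _ <-]]; apply: sub_sigma_algebra.
  exists [fset g]%fset; first by move=> h; rewrite inE => /eqP ->.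
  by move=> x y xy [_ Yx]; split=> //; rewrite /preimage/= -xy// inE.
by move=> A [D DS lA]; exact: local_set_measurable lA.
Qed.

Lemma local_sets_setI S : setI_closed (local_sets S).
Proof.
move=> A B [D DS lA] [D' DS' lB]; exists (D `|` D')%fset.
  by move=> g; rewrite in_fsetU => /orP[/DS|/DS'].
apply: local_setI; [apply: local_set_sub lA|apply: local_set_sub lB].
  exact: fsubsetUl.
exact: fsubsetUr.
Qed.

Lemma local_setsT S : local_sets S setT.
Proof. by exists fset0. Qed.

Lemma sub_borel_config S A : <<s coord_system S >> A ->
  measurable (A : set (borel_config G)).
Proof.
rewrite measurable_borel_config; apply: sub_smallest2r => //.
by move=> B [g _ ?]; exists g.
Qed.

Lemma local_fun_measurable {R : realType} S D (f : config G -> R) :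
  (forall g, g \in D -> S g) -> (forall x y, eq_on D x y -> f x = f y) ->
  measurable_fun setT (f : g_sigma_algebraType (coord_system S) -> R).
Proof.
move=> DS lf _ Y mY; rewrite setTI; apply: (local_set_measurable DS).
by move=> x y xy; rewrite /preimage/= (lf x y xy).
Qed.

Lemma measurable_fun_borel_config {R : realType} S (f : config G -> R) :
  measurable_fun setT (f : g_sigma_algebraType (coord_system S) -> R) ->
  measurable_fun setT (f : borel_config G -> R).
Proof.
move=> mf _ Y mY; have := mf measurableT Y mY.
by rewrite !setTI => /sub_borel_config.
Qed.

Lemma measurable_config_act h :
  measurable_fun setT (config_act h : borel_config G -> borel_config G).
Proof.
apply: (@measurability _ _ _ _ setT
  (config_act h : borel_config G -> borel_config G) (coord_system setT)).
  exact: measurable_borel_config.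
move=> _ [_ [g _ [Y _ <-]] <-]; rewrite !setTI.
apply: (@local_set_borel [fset g * h]%g%fset) => x y xy.
by rewrite /preimage/= /config_act xy// inE.
Qed.

Lemma measurable_config_glue (K : {fset G}) (w : {ffun K -> nat})
    (B : set (borel_config G)) :
  measurable B ->
  <<s coord_system (~` [set` K]) >> [set x | B (config_glue w x)].
Proof.
move=> mB.
have mg : measurable_fun setT
    (config_glue w :
      g_sigma_algebraType (coord_system (~` [set` K])) -> borel_config G).
  apply: (@measurability _ _ _ _ setT
    (config_glue w :
      g_sigma_algebraType (coord_system (~` [set` K])) -> borel_config G)
    (coord_system setT)); first exact: measurable_borel_config.
  move=> _ [_ [g _ [Y _ <-]] <-]; rewrite !setTI.
  (* If [g] is in [K] this set of sites is empty, and the glued coordinate is constant. *)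
  apply: (@local_set_measurable _ ([fset g] `\` K)%fset) => [h|x y xy].
    by rewrite in_fsetD => /andP[/negP].
  rewrite /preimage/= /config_glue; case: insubP => //= gK.
  by rewrite (xy g)// in_fsetD gK in_fset1 eqxx.
by have := mg measurableT B mB; rewrite setTI.
Qed.

Lemma local_sets_measure_unique {R : realType} S
    (m1 m2 : {measure set (borel_config G) -> \bar R}) :
  (m1 setT < +oo)%E -> (forall A, local_sets S A -> m1 A = m2 A) ->
  forall A, <<s coord_system S >> A -> m1 A = m2 A.
Proof.
move=> m1oo m12; rewrite coord_local_sets.
have sub : local_sets S `<=` @measurable _ (borel_config G).
  by move=> A [D _ lA]; exact: local_set_borel lA.
have cover : \bigcup_(k in [set: nat]) [set: borel_config G] = setT.
  by rewrite bigcup_const.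
exact: (@g_sigma_algebra_measure_unique _ R (borel_config G) (local_sets S) sub
  (fun=> setT) (fun=> local_setsT S) cover m1 m2 (@local_sets_setI S) m12
  (fun=> m1oo)).
Qed.

End BorelConfig.

(** * Measures from tight contents *)

Section ContentMeasure.
Context {R : realType} {G : groupType}.
Context (m : set (config G) -> R) (cm : content m).
Implicit Types (A B : set (config G)).

Lemma content0 : m set0 = 0.
Proof.
case: cm => _ _ mU; have := mU set0 set0; rewrite setU0.
have d0 : [disjoint (set0 : set (config G)) & set0].
  by apply/disj_setPS; rewrite setI0.
by move=> /(_ d0); lra.
Qed.

Lemma content_le A B : A `<=` B -> m A <= m B.
Proof.
case: cm => m0 _ mU AB; rewrite -(setDUK AB) mU ?lerDl//.
by apply/disj_setPS => x [Ax [_]].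
Qed.

Lemma contentC A : m (~` A) = 1 - m A.
Proof.
case: cm => _ mT mU; have := mU A (~` A); rewrite setUv mT.
by move=> ->; [lra|apply/disj_setPS; rewrite setICr].
Qed.

Lemma content_split A (f : config G -> nat) n :
  m A = \sum_(a < n) m (A `&` [set x | f x = a]) + m (A `&` [set x | (n <= f x)%N]).
Proof.
case: cm => _ _ mU; elim: n => [|n IHn].
  rewrite big_ord0 add0r; congr m; apply/seteqP.
  by split=> [x Ax|x []//]; split.
rewrite IHn big_ord_recr/= -addrA; congr (_ + _).
rewrite -mU; last first.
  by apply/disj_setPS => x [[_ /= fx] [_ /=]]; rewrite fx ltnn.
congr m; apply/seteqP; split => x /=.
  move=> [Ax]; rewrite leq_eqVlt => /predU1P[->|nf]; [by left|by right].
by move=> [[Ax ->]|[Ax /ltnW nf]].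
Qed.

(** Each finite partial sum is the content of a disjoint union inside [A]; finite additivity gives
    this direction only. *)
Lemma content_esum_le (I : countType) (F : I -> set (config G)) A :
  trivIset setT F -> (forall i, F i `<=` A) ->
  (\esum_(i in [set: I]) (m (F i))%:E <= (m A)%:E)%E.
Proof.
case: cm => m0 _ mU tF FA; apply: ge_ereal_sup => _ [X [finX _] <-].
rewrite fsbig_finite//= sumEFin lee_fin.
have -> : \sum_(i <- fset_set X) m (F i) = m (\bigcup_(i in [set` fset_set X]) F i).
  elim/finSet_rect: (fset_set X) => Y IH; have [->|[y yY]] := fset_0Vmem Y.
    by rewrite big_seq_fset0 bigcup0 ?content0.
  rewrite (big_fsetD1 y)//= IH ?fproperD1// -mU.
    congr m; apply/seteqP; split=> [x [Fy|[i /=]]|x [i /= iY Fi]].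
    - by exists y.
    - by rewrite in_fsetD1 => /andP[_ iY] Fi; exists i.
    - have [<-|iy] := eqVneq i y; first by left.
      by right; exists i => //=; rewrite in_fsetD1 iy.
  apply/disj_setPS => x [Fy [i /=]]; rewrite in_fsetD1 => /andP[/eqP iy _] Fi.
  by apply: iy; apply: tF => //; exists x.
by apply: content_le => x [i _ /FA].
Qed.

Context (t : nat -> R) (t0 : t @ \oo --> 0).
Hypothesis tight : forall g M, m [set x | (M <= x g)%N] <= t M.
Context (i : G -> nat) (j : nat -> G) (ij : cancel i j) (ji : cancel j i).

Let C (s : seq nat) : set (config G) :=
  [set x | forall k, (k < size s)%N -> x (j k) = nth 0%N s k].

Let p s := m (C s).

Let C_rcons s a : C (rcons s a) = C s `&` [set x | x (j (size s)) = a].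
Proof.
apply/seteqP; split => x /=.
  move=> xs; split=> [k ks|]; have := xs.
    by move=> /(_ k); rewrite size_rcons nth_rcons ks ltnW//; apply.
  by move=> /(_ (size s)); rewrite size_rcons nth_rcons ltnn eqxx ltnSn; apply.
move=> [xs xa] k; rewrite size_rcons ltnS leq_eqVlt nth_rcons => /predU1P[->|ks].
  by rewrite ltnn eqxx.
by rewrite ks xs.
Qed.

Let p_ge0 s : 0 <= p s. Proof. by case: cm => + _ _; apply. Qed.

Let p_nil : p [::] = 1.
Proof.
case: cm => _ mT _; rewrite -mT; congr m; apply/seteqP; by split.
Qed.

Let p_split s n : p s = \sum_(a < n) p (rcons s a) +
  m (C s `&` [set x | (n <= x (j (size s)))%N]).
Proof.
rewrite {1}/p (content_split _ (fun x => x (j (size s))) n); congr (_ + _).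
by apply: eq_bigr => a _; rewrite /p C_rcons.
Qed.

Let p_sum_le (s : seq nat) n : \sum_(a < n) p (rcons s a) <= p s.
Proof. by rewrite (p_split s n) lerDl; case: cm. Qed.

(** Tightness at the site [j (size s)] prevents loss of mass: the children of [s] together carry all
    of [p s]. *)
Let p_sum_ge (s : seq nat) e : 0 < e ->
  exists n, p s - e < \sum_(a < n) p (rcons s a).
Proof.
move=> e0; have /cvgrPdist_lt /(_ _ e0)[n _ /(_ n (leqnn n))] := t0.
rewrite sub0r normrN => tn; exists n; rewrite ltrBlDr [ltLHS](p_split s n) ltrD2l.
apply: le_lt_trans tn; apply: le_trans (ler_norm _).
by apply: le_trans (tight (j (size s)) n); apply: content_le => x [].
Qed.

(** Left endpoint of the interval of [s]: the total mass of the prefixes that agree with [s] before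
    some position [k] and have a smaller entry at [k]. *)
Let lo (s : seq nat) :=
  \sum_(k < size s) \sum_(b < nth 0%N s k) p (rcons (take k s) b).

Let lo_rcons s a : lo (rcons s a) = lo s + \sum_(b < a) p (rcons s b).
Proof.
rewrite /lo size_rcons big_ord_recr/=; congr (_ + _).
  apply: eq_bigr => k _; rewrite nth_rcons ltn_ord; apply: eq_bigr => b _.
  by rewrite -[rcons s a]cats1 takel_cat// ltnW.
by rewrite nth_rcons ltnn eqxx -[rcons s a]cats1 take_size_cat.
Qed.

(* The intervals [J s], [size s = n], partition [[0, 1[] and refine each other;
   a point [u] is sent to the configuration whose digits [s] satisfy [J s u]. *)
Let J s : set (measurableTypeR R) := [set u | lo s <= u < lo s + p s].

Let J_sub s a : J (rcons s a) `<=` J s.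
Proof.
move=> u; rewrite /J/= lo_rcons => /andP[lu ul].
have sum0 : 0 <= \sum_(b < a) p (rcons s b) by rewrite sumr_ge0.
have := p_sum_le s a.+1; rewrite big_ord_recr/= => ple.
by apply/andP; split; lra.
Qed.

Let J_cover s u : J s u -> exists a, J (rcons s a) u.
Proof.
move=> /andP[lu ul].
have e0 : 0 < lo s + p s - u by lra.
have ex : exists n, u < lo s + \sum_(a < n) p (rcons s a).
  by have [n hn] := p_sum_ge s e0; exists n; lra.
(* The digit is one less than the least number of children whose intervals reach beyond [u]; that
   number is positive since [lo s <= u]. *)
case: (ex_minnP ex) => -[|n] un nmin.
  by move: un; rewrite big_ord0 addr0 => /lt_le_trans/(_ lu); rewrite ltxx.
exists n; rewrite /J/= lo_rcons -addrA.
move: un; rewrite big_ord_recr/= => ->; rewrite andbT leNgt.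
by apply/negP => /nmin; rewrite ltnn.
Qed.

Let J_inj s a b u : J (rcons s a) u -> J (rcons s b) u -> a = b.
Proof.
wlog ab : a b / (a < b)%N => [wl Ja Jb|].
  by case: (ltngtP a b) => // ?; [exact: wl|apply/esym; exact: wl].
move=> /andP[_] + /andP[+ _]; rewrite !lo_rcons => ua bu; exfalso.
have : \sum_(c < a.+1) p (rcons s c) <= \sum_(c < b) p (rcons s c).
  rewrite -(big_mkord xpredT (fun c => p (rcons s c))).
  rewrite -(big_mkord xpredT (fun c => p (rcons s c))).
  by rewrite [leRHS](big_cat_nat _ (n := a.+1))//= lerDl sumr_ge0.
rewrite big_ord_recr/=; lra.
Qed.

Let digit u s := xget 0%N [set a | J (rcons s a) u].

Fixpoint expansion u n :=
  if n is k.+1 then rcons (expansion u k) (digit u (expansion u k)) else [::].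

Let size_expansion u n : size (expansion u n) = n.
Proof. by elim: n => //= n IHn; rewrite size_rcons IHn. Qed.

Let J_expansion u n : J [::] u -> J (expansion u n) u.
Proof.
move=> Ju; elim: n => //= n IHn; rewrite /digit.
exact: (xgetPex 0%N (J_cover IHn)).
Qed.

Let J_nil s : J s `<=` J [::].
Proof. by elim/last_ind: s => // s a IHs u /J_sub /IHs. Qed.

Let expansionE u s : J s u -> expansion u (size s) = s.
Proof.
elim/last_ind: s => // s a IHs Ju; have Jsu := J_sub Ju.
rewrite size_rcons/= IHs//; congr rcons; apply: J_inj Ju.
exact: (xgetPex 0%N (J_cover Jsu)).
Qed.

Let X (u : measurableTypeR R) : borel_config G :=
  fun g => digit u (expansion u (i g)).

Let nth_expansion u n k : (k < n)%N -> nth 0%N (expansion u n) k = X u (j k).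
Proof.
move=> kn; rewrite /X ji; elim: n kn => // n IHn.
rewrite ltnS leq_eqVlt => /predU1P[->|kn] /=.
  by rewrite nth_rcons size_expansion ltnn eqxx.
by rewrite nth_rcons size_expansion kn IHn.
Qed.

(** Within [[0, 1[], the preimage under [X] of the cylinder of [s] is the interval [J s], whose
    length is the required mass [p s]. *)
Let X_C u s : J [::] u -> C s (X u) <-> J s u.
Proof.
move=> Ju; split=> [Cs|Js k ks]; 
  last by rewrite -(nth_expansion u ks) (expansionE Js).
rewrite (_ : s = expansion u (size s)); first exact: J_expansion.
apply: (@eq_from_nth _ 0%N) => [|k ks]; first by rewrite size_expansion.
by rewrite nth_expansion// Cs.
Qed.

Let measurable_J s : measurable (J s).
Proof.
by rewrite (_ : J s = `[lo s, lo s + p s[%classic).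
Qed.

Context (E : nat -> {fset G}) (exhE : exhausting E).

Let measurable_X : measurable_fun setT X.
Proof.
apply: (@measurability _ _ _ _ setT X (coord_system setT)).
  exact: (measurable_borel_config exhE).
move=> _ [_ [g _ [Y _ <-]] <-]; rewrite !setTI.
(* Off [[0, 1[] no digit exists and [xget] returns its default 0. Inside, coordinate [g] is the last
   digit of the expansion of length [i g + 1], so its level sets are countable unions of
   intervals. *)
have outside u : ~ J [::] u -> X u g = 0%N.
  move=> NJ; rewrite /X /digit; apply: xgetPN => a Ja; exact/NJ/J_nil/Ja.
pose F (s : seq nat) :=
  if `[< size s = (i g).+1 /\ Y (last 0%N s) >] then J s else set0.
have -> : X @^-1` (@^~ g @^-1` Y) =
    (\bigcup_s F s) `|` (~` J [::] `&` [set u | Y 0%N]).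
  apply/seteqP; split=> u; rewrite /preimage/=.
    move=> YX; have [Ju|NJu] := pselect (J [::] u).
      left; exists (expansion u (i g).+1) => //; rewrite /F.
      case: asboolP => [_|]; first exact: (J_expansion (i g).+1 Ju).
      by case; rewrite size_expansion/= last_rcons.
    by right; split=> //; move: YX; rewrite outside.
  move=> [[s _]|[NJu]]; last by rewrite outside.
  rewrite /F; case: asboolP => // -[sg Ys] Js.
  by rewrite /X; move: Ys; rewrite -(expansionE Js) sg/= last_rcons.
apply: measurableU.
  apply: countable_bigcupT_measurable => // s; rewrite /F.
  by case: asboolP => _; [exact: measurable_J|exact: measurable0].
apply: measurableI; first by apply: measurableC; exact: measurable_J.
by have [Y0|Y0] := pselect (Y 0%N); [rewrite (_ : [set _ | _] = setT)//|
  rewrite (_ : [set _ | _] = set0)//]; apply/seteqP; split.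
Qed.

Lemma content_measure : exists mu : probability (borel_config G) R,
  forall D (A : set (borel_config G)), local_set D A -> mu A = (m A)%:E.
Proof.
pose XM : {mfun (measurableTypeR R) >-> borel_config G} :=
  HB.pack X (isMeasurableFun.Build _ _ _ _ X measurable_X).
pose P : probability (measurableTypeR R) R := uniform_prob (@ltr01 R).
pose mu : probability (borel_config G) R := distribution P XM.
exists mu.
have J01 : J [::] = `[0, 1[%classic.
  apply/seteqP; split=> u; rewrite /J/= in_itv/= p_nil /lo big_ord0 add0r//.
have PE (A : set (measurableTypeR R)) :
    measurable A -> A `<=` J [::] -> P A = lebesgue_measure A.
  move=> mA AJ; rewrite /P/= /uniform_prob (eq_integral (fun=> 1%:E)).
    by rewrite integral_cst// mul1e.
  move=> u /set_mem/AJ; rewrite J01/= in_itv/= => /andP[u0 u1].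
  by rewrite /uniform_pdf u0 (ltW u1) subr0 invr1.
have leb_J s : lebesgue_measure (J s) = (p s)%:E.
  rewrite (_ : J s = `[lo s, lo s + p s[%classic); last first.
    by apply/seteqP; split=> u; rewrite /J/= in_itv.
  rewrite lebesgue_measure_itv/= lte_fin ltrDl; case: ifPn => [_|].
    by rewrite -EFinB addrAC subrr add0r.
  by rewrite -leNgt => p0; congr _%:E; apply/eqP; rewrite eq_le p_ge0 p0.
have PJ s : P (J s) = (p s)%:E by rewrite PE// ?leb_J//; exact: J_nil.
(* [J [::]] has full mass, so the default digits outside it do not influence the law of [X]. *)
have POut (A : set (measurableTypeR R)) : measurable A -> P (A `\` J [::]) = 0%E.
  move=> mA; apply/eqP; rewrite eq_le measure_ge0 andbT.
  have <- : P (~` J [::]) = 0%E by rewrite probability_setC// PJ p_nil subee.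
  by apply: le_measure; rewrite ?inE//; [exact: measurableD|exact: measurableC].
have localC s : local_set [fset j k | k in iota 0 (size s)]%fset (C s).
  move=> x y xy Cx k ks; rewrite -xy ?Cx//; apply/imfsetP; exists k => //=.
  by rewrite mem_iota.
have mC s : measurable (C s : set (borel_config G)).
  exact: (local_set_borel exhE (localC s)).
have muC s : mu (C s) = (p s)%:E.
  have mXC : measurable (X @^-1` C s).
    by rewrite -[X in measurable X]setTI; apply: measurable_X.
  rewrite -[LHS]/(P (X @^-1` C s)) (measureDI _ mXC (measurable_J [::])).
  rewrite [X in (X + _)%E]POut// add0e -PJ; congr (P _).
  apply/seteqP; split=> [u [/= CX J0]|u Ju]; first exact/X_C.
  by have J0 := J_nil Ju; split=> //; exact/X_C.
(* By finite additivity, [m A] dominates every finite partial sum of the series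
   giving [mu A]; applied to [A] and to its complement this yields equality. *)
have mu_le D (A : set (borel_config G)) : local_set D A -> (mu A <= (m A)%:E)%E.
  (* The first [N] sites in the enumeration include all of [D], so [A] is a union of sets [C w] with
     [w] of length [N]. *)
  move=> lA; pose N := (\max_(g <- D) i g).+1.
  pose F (w : N.-tuple nat) := if `[< C w `<=` A >] then C w else set0.
  have tF : trivIset setT F.
    move=> v w _ _ [x []]; rewrite /F; case: asboolP => // _ xv.
    case: asboolP => // _ xw.
    apply: val_inj; apply: (@eq_from_nth _ 0%N) => [|k]; rewrite !size_tuple// => kN.
    by rewrite -xv ?size_tuple// -xw ?size_tuple.
  have AE : A = \bigcup_w F w.
    apply/seteqP; split=> [x Ax|x [w _]]; last first.
      by rewrite /F; case: asboolP => // sub /sub.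
    exists [tuple x (j k) | k < N] => //; rewrite /F; case: asboolP => [_ k|].
      rewrite size_tuple => kN; rewrite (_ : k = Ordinal kN)// -tnth_nth.
      by rewrite tnth_mktuple.
    case=> y Cy; apply: lA Ax => g gD.
    have gN : (i g < N)%N by rewrite ltnS; exact: (@leq_bigmax_seq _ _ xpredT i).
    have := Cy (i g); rewrite size_tuple => /(_ gN); rewrite ij => ->.
    by rewrite -[i g]/(nat_of_ord (Ordinal gN)) -tnth_nth tnth_mktuple/= ij.
  rewrite {1}AE measure_bigcup_esum//; last first.
    by move=> w; rewrite /F; case: asboolP => _; [exact: mC|exact: measurable0].
  have FA w : F w `<=` A by rewrite /F; case: asboolP => // _ x [].
  apply: le_trans (content_esum_le tF FA).
  apply: le_esum => w _; rewrite /F; case: asboolP => _.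
    by rewrite -[X in (_ <= X)%E]/((p w)%:E) -muC; exact: lexx.
  by rewrite measure0 content0.
move=> D A lA; apply/eqP; rewrite eq_le (mu_le D)//.
have mA := local_set_borel exhE lA.
have := mu_le _ _ (local_setC lA); rewrite contentC probability_setC//.
have : mu A \is a fin_num by exact: fin_num_measure.
by case: (mu A) => // r _; rewrite -EFinB !lee_fin lerD2l lerN2.
Qed.

End ContentMeasure.

(** * The DLR property of the limit *)

Section LimitMeasure.
Context {R : realType} {G : groupType} (phi : config G -> R).
Context (E : nat -> {fset G}) (exhE : exhausting E).
Hypothesis var_phi : summable_variation phi E.
Hypothesis exp_phi : exp_summable phi.
Context (m : set (config G) -> R) (mu : probability (borel_config G) R).
Hypothesis mu_local :
  forall (D : {fset G}) (A : set (borel_config G)), local_set D A -> mu A = (m A)%:E.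

(** The image of [B] under [g] is its preimage under [g^-1]. The push-forward of [mu] by [g^-1]
    agrees with [mu] on local sets, hence on all Borel sets. *)
Lemma act_invariant_of_local :
  (forall h B, m [set x | B (config_act h x)] = m B) -> act_invariant mu.
Proof.
move=> minv g B mB.
pose f : {mfun borel_config G >-> borel_config G} :=
  HB.pack (config_act g^-1%g : borel_config G -> borel_config G)
    (isMeasurableFun.Build _ _ _ _
       (config_act g^-1%g : borel_config G -> borel_config G)
       (measurable_config_act exhE g^-1)).
have -> : config_act g @` B = [set x | B (config_act g^-1%g x)].
  apply/seteqP; split=> [_ [x Bx <-]|x /= Bx].
    by rewrite /= config_actM mulVg config_act1.
  by exists (config_act g^-1%g x) => //; rewrite config_actM mulgV config_act1.
have eqmu := @local_sets_measure_unique G E exhE R setT (distribution mu f) mu.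
rewrite -[LHS]/(distribution mu f B); apply: eqmu.
- by rewrite -ge0_fin_numE// fin_num_measure.
- move=> A [D _ lA]; transitivity (m A)%:E; last exact/esym/(mu_local lA).
  rewrite -[LHS]/(mu [set x | A (config_act g^-1%g x)]).
  rewrite (@mu_local [fset h * g^-1 | h in D]%g%fset) ?minv// => x y xy.
  by apply: lA => h hD; rewrite /config_act xy//; apply/imfsetP; exists h.
- by rewrite -(measurable_borel_config exhE).
Qed.

Context (K : {fset G}).

Let kernel (w : {ffun K -> nat}) x := dlr_kernel phi E K (cylinder w) x.

(** Replacing [x] by 0 off [E n] makes the finite-volume ratio a function of the coordinates in
    [E n \ K], hence measurable. [dlr_kernel_approx] allows volume and boundary to vary together, so
    these functions converge to the kernel. *)
Lemma measurable_dlr_kernel_cylinder w : measurable_fun setT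
  (kernel w : g_sigma_algebraType (coord_system (~` [set` K])) -> R).
Proof.
pose restr n (x : config G) : config G := fun g => if g \in E n then x g else 0%N.
apply: (@measurable_fun_cvg _
    (g_sigma_algebraType (coord_system (~` [set` K]))) R setT
    (fun n x => gibbs_ratio phi (E n) K (cylinder w) (restr n x))) => [n|x _].
  apply: (@local_fun_measurable _ _ _ (E n `\` K)%fset) => [g|x y xy].
    by rewrite in_fsetD => /andP[/negP].
  have rxy : eq_off K (restr n x) (restr n y).
    by move=> g gK; rewrite /restr; case: ifP => // gE; rewrite xy// in_fsetD gK.
  rewrite /gibbs_ratio /gibbs_weight.
  congr (fine _ / fine _); apply: eq_esum => v _;
    by rewrite (config_glue_eq v rxy).
apply/cvgrPdist_le => e e0.
have [P [D [KP HP]]] := dlr_kernel_approx exhE var_phi exp_phi K e0.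
near=> n; rewrite distrC; apply: HP => [||v]; last by rewrite !cylinder_glue.
  by near: n; exact: exhausting_near.
move=> g; rewrite in_fsetD => /andP[_ gD].
have DE : (D `<=` E n)%fset by near: n; exact: exhausting_near.
by rewrite /restr (fsubsetP DE).
Unshelve. all: by end_near. Qed.

Let kernel_measurable w : measurable_fun setT (kernel w : borel_config G -> R).
Proof.
exact: (measurable_fun_borel_config exhE (measurable_dlr_kernel_cylinder w)).
Qed.

Let kernel_ge0 w x : (0 <= (kernel w x)%:E)%E.
Proof. by rewrite lee_fin; exact: dlr_kernel_ge0. Qed.

Definition kernel_density w (A : set (borel_config G)) : \bar R :=
  (\int[mu]_(x in A) (kernel w x)%:E)%E.

Let kernel_density_measure w : {nu : {measure set (borel_config G) -> \bar R} |
  forall A, nu A = kernel_density w A}.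
Proof.
have nu0 : kernel_density w set0 = 0%E by rewrite /kernel_density integral_set0.
have nu_ge0 A : (0 <= kernel_density w A)%E.
  by apply: integral_ge0 => x _; exact: kernel_ge0.
have nu_add : semi_sigma_additive (kernel_density w).
  move=> /= F mF tF mUF; rewrite /kernel_density; apply: cvg_toP.
    apply: ereal_nondecreasing_is_cvgn => k n kn.
    apply: lee_sum_nneg_natr => // l _ _; exact: nu_ge0.
  have mk : measurable_fun (\bigcup_n F n)
      (fun x : borel_config G => (kernel w x)%:E).
    by apply: measurable_funTS; apply/measurable_EFinP; exact: kernel_measurable.
  by rewrite (ge0_integral_bigcup mu mF mk (fun x _ => kernel_ge0 w x) tF).
pose nu : {measure set (borel_config G) -> \bar R} :=
  HB.pack (kernel_density w)
    (isMeasure.Build _ _ _ (kernel_density w) nu0 nu_ge0 nu_add).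
by exists nu.
Qed.

Hypothesis dlr_m : approx_dlr phi E m.

Let measurable_cylinder (D : {fset G}) (w : {ffun D -> nat}) :
  measurable (cylinder w : set (borel_config G)).
Proof. exact: (local_set_borel exhE (@local_cylinder _ _ w)). Qed.

(** Both kernel values are within [e / 2] of the same finite-volume ratio. *)
Lemma dlr_kernel_osc (w : {ffun K -> nat}) e : 0 < e -> exists D : {fset G},
  forall x y, eq_on (D `\` K)%fset x y -> `|kernel w x - kernel w y| <= e.
Proof.
move=> e0; have e2 : 0 < e / 2 by rewrite divr_gt0.
have [P [D [KP HP]]] := dlr_kernel_approx exhE var_phi exp_phi K e2.
exists D => x y xy.
have Px := HP P (cylinder w) (cylinder w) x x (fsubset_refl P) (fun=> fun=> erefl)
  (fun=> iff_refl _).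
have Py := HP P (cylinder w) (cylinder w) x y (fsubset_refl P) xy _.
apply: dist_le_half Px (Py _) => v.
by rewrite !cylinder_glue.
Qed.

Lemma insensitive_local_set (D : {fset G}) (A : set (config G)) :
  [disjoint D & K]%fset -> local_set D A -> insensitive K A.
Proof.
move=> /fdisjointP dDK lA x y xy; apply: lA => g /dDK; exact: xy.
Qed.

(** On a cylinder fixing enough sites off [K], the kernel stays within [e / 2] of its value at [x0],
    and [approx_dlr] costs another [e / 2]. Both errors are relative to the mass of the cylinder. *)
Let density_cylinder (w : {ffun K -> nat}) e : 0 < e -> exists D : {fset G},
  forall (D' : {fset G}) (a : {ffun D' -> nat}),
    (D `\` K `<=` D')%fset -> [disjoint D' & K]%fset ->
  (mu (cylinder a `&` cylinder w) <=
     kernel_density w (cylinder a) + e%:E * mu (cylinder a))%E /\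
  (kernel_density w (cylinder a) <=
     mu (cylinder a `&` cylinder w) + e%:E * mu (cylinder a))%E.
Proof.
move=> e0; have e2 : 0 < e / 2 by rewrite divr_gt0.
have [D1 HD1] := dlr_m K e2; have [D2 HD2] := dlr_kernel_osc w e2.
exists (D1 `|` D2)%fset => D' a DD' dD'K.
have [D1D' D2D'] : (D1 `\` K `<=` D')%fset /\ (D2 `\` K `<=` D')%fset.
  by split; apply: fsubset_trans DD'; apply: fsetSD; rewrite ?fsubsetUl ?fsubsetUr.
pose x0 := config_glue a (fun=> 0%N).
have ax0 : cylinder a x0 by exact/cylinder_glue.
have ax x : cylinder a x -> eq_on D' x x0 by move=> ?; exact: cylinder_eq_on ax0.
have H1 := HD1 (cylinder a) x0 w
  (insensitive_local_set dD'K (@local_cylinder _ _ a)).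
have {}H1 : `|m (cylinder a `&` cylinder w) - kernel w x0 * m (cylinder a)| <=
    e / 2 * m (cylinder a).
  by apply: H1 => x /ax xx0 g /(fsubsetP D1D'); exact: xx0.
have H2 x : cylinder a x -> `|kernel w x - kernel w x0| <= e / 2.
  by move=> /ax xx0; apply: HD2 => g /(fsubsetP D2D'); exact: xx0.
have mua := mu_local (@local_cylinder _ _ a).
have muaw : mu (cylinder a `&` cylinder w) = (m (cylinder a `&` cylinder w))%:E.
  apply: (@mu_local (D' `|` K)%fset); apply: local_setI.
    by apply: local_set_sub (@local_cylinder _ _ a); exact: fsubsetUl.
  by apply: local_set_sub (@local_cylinder _ _ w); exact: fsubsetUr.
have ma0 : 0 <= m (cylinder a) by rewrite -lee_fin -mua measure_ge0.
have k0 : 0 <= kernel w x0 by exact: dlr_kernel_ge0.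
have mk : measurable_fun (cylinder a : set (borel_config G))
    (fun x : borel_config G => (kernel w x)%:E).
  by apply: measurable_funTS; apply/measurable_EFinP; exact: kernel_measurable.
have cstE c : (\int[mu]_(x in (cylinder a : set (borel_config G))) c%:E =
    (c * m (cylinder a))%:E)%E.
  by rewrite integral_cst// EFinM -mua.
have up : (kernel_density w (cylinder a) <=
    ((kernel w x0 + e / 2) * m (cylinder a))%:E)%E.
  rewrite -cstE /kernel_density.
  apply: (@ge0_le_integral _ _ R mu _ (measurable_cylinder a)
      (fun x => (kernel w x)%:E) (fun=> (kernel w x0 + e / 2)%:E)).
  - by move=> x _; exact: kernel_ge0.
  - exact: mk.
  - exact: measurable_cst.
  - by move=> x /H2 H; rewrite lee_fin -lerBlDl; exact: le_trans (ler_norm _) H.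
have down : (((kernel w x0 - e / 2) * m (cylinder a))%:E <=
    kernel_density w (cylinder a))%E.
  (* Monotonicity of the integral is applied to nonnegative integrands; if the constant is negative,
     the bound is immediate. *)
  have [ke|ke] := leP (e / 2) (kernel w x0); last first.
    apply: (@le_trans _ _ 0%E); last first.
      by apply: integral_ge0 => x _; exact: kernel_ge0.
    by rewrite lee_fin mulr_le0_ge0// subr_le0 ltW.
  rewrite -cstE /kernel_density.
  apply: (@ge0_le_integral _ _ R mu _ (measurable_cylinder a)
      (fun=> (kernel w x0 - e / 2)%:E) (fun x => (kernel w x)%:E)).
  - by move=> x _; rewrite lee_fin subr_ge0.
  - exact: measurable_cst.
  - exact: mk.
  - move=> x /H2 H; rewrite lee_fin lerBlDr -lerBlDl.
    by rewrite distrC in H; exact: le_trans (ler_norm _) H.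
rewrite mua muaw -EFinM; split.
  apply: le_trans (leeD2r _ down); rewrite -EFinD lee_fin.
  by move: H1; rewrite ler_norml; lra.
apply: (le_trans up); rewrite -EFinD lee_fin.
by move: H1; rewrite ler_norml; lra.
Qed.

Lemma integral_dlr_kernel_local (w : {ffun K -> nat}) (D : {fset G})
    (A : set (borel_config G)) :
  [disjoint D & K]%fset -> local_set D A ->
  mu (A `&` cylinder w) = kernel_density w A.
Proof.
move=> dDK lA; have [nu nuE] := kernel_density_measure w.
pose rho : {measure set (borel_config G) -> \bar R} :=
  mrestr mu (measurable_cylinder w).
have mA := local_set_borel exhE lA.
suff H e : 0 < e -> (rho A <= nu A + e%:E)%E /\ (nu A <= rho A + e%:E)%E.
  rewrite -nuE -[LHS]/(rho A); apply/eqP; rewrite eq_le; apply/andP; split;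
    by apply/lee_addgt0Pr => e /H[].
move=> e0; have [D1 HD1] := density_cylinder w e0.
(* Refining [D] by [D1 \ K] cuts [A] into cylinders small enough for [density_cylinder]; the errors
   then add up to at most [e]. *)
pose D' := (D `|` (D1 `\` K))%fset.
have dD'K : [disjoint D' & K]%fset.
  apply/fdisjointP => g; rewrite in_fsetU => /orP[gD|].
    by move/fdisjointP: dDK; apply.
  by rewrite in_fsetD => /andP[].
have lA' : local_set D' A by apply: local_set_sub lA; exact: fsubsetUl.
pose F (a : {ffun D' -> nat}) : set (borel_config G) :=
  if `[< cylinder a `<=` A >] then cylinder a else set0.
have AE : A = \bigcup_a F a := local_set_bigcup lA'.
have mF a : measurable (F a).
  by rewrite /F; case: asboolP => _; [exact: measurable_cylinder|exact: measurable0].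
have tF : trivIset setT F.
  move=> a b _ _ [x []]; rewrite /F; case: asboolP => // _ xa.
  case: asboolP => // _ xb.
  by apply: (@trivIset_cylinder G D') => //; exists x.
have sumE (l : {measure set (borel_config G) -> \bar R}) :
    l A = (\esum_(a in [set: {ffun D' -> nat}]) l (F a))%E.
  by rewrite {1}AE measure_bigcup_esum.
have HF a : (rho (F a) <= nu (F a) + e%:E * mu (F a))%E /\
    (nu (F a) <= rho (F a) + e%:E * mu (F a))%E.
  rewrite /F; case: asboolP => _; last by rewrite !measure0 mule0 adde0.
  rewrite nuE -[rho _]/(mu (cylinder a `&` cylinder w)).
  by apply: HD1 => //; exact: fsubsetUr.
have cmp (l l' : {measure set (borel_config G) -> \bar R}) :
    (forall a, l (F a) <= l' (F a) + e%:E * mu (F a))%E -> (l A <= l' A + e%:E)%E.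
  move=> ll'; apply: (@le_trans _ _ (l' A + e%:E * mu A)%E).
    rewrite (sumE l) (sumE l') (sumE mu) -esumZl ?(ltW e0)//.
    rewrite -esumD//; last by move=> a _; rewrite mule_ge0// lee_fin ltW.
    exact: le_esum.
  rewrite leeD2l// -[leRHS]mule1 lee_wpmul2l ?lee_fin ?(ltW e0)//.
  exact: probability_le1.
by split; apply: cmp => a; case: (HF a).
Qed.

Lemma integral_dlr_kernel (w : {ffun K -> nat}) (A : set (borel_config G)) :
  <<s coord_system (~` [set` K]) >> A -> mu (A `&` cylinder w) = kernel_density w A.
Proof.
have [nu nuE] := kernel_density_measure w.
pose rho : {measure set (borel_config G) -> \bar R} :=
  mrestr mu (measurable_cylinder w).
move=> sA; rewrite -nuE -[LHS]/(rho A); move: A sA.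
apply: (local_sets_measure_unique exhE).
  rewrite -[X in (X < _)%E]/(mu (setT `&` cylinder w)).
  by rewrite -ge0_fin_numE// fin_num_measure// setTI.
move=> A [D DK lA]; rewrite nuE; apply: integral_dlr_kernel_local lA.
by apply/fdisjointP => g /DK /negP.
Qed.

(** By [dlr_kernel_esum] the kernel of [B] is a countable sum over patterns [w]. Its integral over
    [A] is computed term by term, the term of [w] giving the mass of the part of [A] and [B] inside
    [cylinder w]. *)
Lemma dlr_kernel_cond_prob (B : set (borel_config G)) : measurable B ->
  cond_prob_version mu (coord_system (~` [set` K])) B (dlr_kernel phi E K B).
Proof.
move=> mB; pose S := ~` [set` K].
pose term (w : {ffun K -> nat}) x := kernel w x * \1_B (config_glue w x).
have term0 w x : (0 <= (term w x)%:E)%E.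
  by rewrite lee_fin mulr_ge0//; exact: dlr_kernel_ge0.
have kernelE x : ((dlr_kernel phi E K B x)%:E =
    \sum_(n <oo) oapp (fun w => (term w x)%:E) 0 (@pickle_inv {ffun K -> nat} n))%E.
  rewrite (dlr_kernel_esum exhE var_phi exp_phi).
  by apply: esum_countType => w; exact: term0.
have mterm w : measurable_fun setT
    ((fun x => (term w x)%:E) : g_sigma_algebraType (coord_system S) -> \bar R).
  apply/measurable_EFinP; apply: measurable_funM.
    exact: measurable_dlr_kernel_cylinder.
  rewrite (_ : (fun x => _) = \1_[set x | B (config_glue w x)]) //.
  by apply: measurable_indic; exact: (measurable_config_glue exhE).
pose h n x := oapp (fun w => (term w x)%:E) 0%E (@pickle_inv {ffun K -> nat} n).
have h0 n x : (0 <= h n x)%E by rewrite /h; case: (pickle_inv n) => //=.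
have mh n : measurable_fun setT
    (h n : g_sigma_algebraType (coord_system S) -> \bar R).
  by rewrite /h; case: (pickle_inv n) => [w|]; [exact: mterm|exact: measurable_cst].
have mkernel : measurable_fun setT
    (dlr_kernel phi E K B : g_sigma_algebraType (coord_system S) -> R).
  apply/measurable_EFinP.
  rewrite (_ : EFin \o _ =
      fun x : g_sigma_algebraType (coord_system S) =>
        \sum_(0 <= n <oo | n \in xpredT) h n x)%E.
    exact: ge0_emeasurable_sum.
  by apply/funext => x; rewrite /= kernelE; exact: eq_eseriesl.
have glue_cylinder (w : {ffun K -> nat}) x : cylinder w x -> config_glue w x = x.
  move=> xw; apply/funext => g; have [gK|gK] := boolP (g \in K).
    by rewrite (config_glue_in w x [` gK]) -xw.
  by rewrite config_glue_off.
split.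
- exact: mkernel.
- apply: measurable_bounded_integrable => //.
  + by rewrite -ge0_fin_numE// fin_num_measure.
  + exact: (measurable_fun_borel_config exhE mkernel).
  + exists 1; split=> // y y1 x _ /=.
    have k0 := dlr_kernel_ge0 exhE var_phi exp_phi K B x.
    have k1 := dlr_kernel_le1 exhE var_phi exp_phi K B x.
    by rewrite ger0_norm// (le_trans k1)// ltW.
move=> A sA; have mA : measurable (A : set (borel_config G)).
  exact: (sub_borel_config exhE sA).
have termE w : (\int[mu]_(x in (A : set (borel_config G))) (term w x)%:E =
    mu ((A `&` B) `&` cylinder w))%E.
  pose Bw : set (borel_config G) := [set x | B (config_glue w x)].
  have sAB : <<s coord_system (~` [set` K]) >> (A `&` Bw).
    apply: (@measurableI _ (g_sigma_algebraType (coord_system S))) => //.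
    exact: (measurable_config_glue exhE).
  (* Gluing [w] changes nothing on [cylinder w], so there [B] may be replaced by [Bw], an event of
     the coordinates off [K], to which [integral_dlr_kernel] applies. *)
  have -> : (A `&` B) `&` cylinder w = (A `&` Bw) `&` cylinder w.
    by apply/seteqP; split=> x [[Ax Bx] xw]; split=> //; split=> //;
      move: Bx; rewrite /Bw/= glue_cylinder.
  rewrite (integral_dlr_kernel w sAB) /kernel_density integral_mkcondr.
  apply: eq_integral => x _; rewrite patchE /term indicE /Bw.
  have -> : (x \in [set x | B (config_glue w x)]) = (config_glue w x \in B).
    by apply/idP/idP; rewrite !inE.
  by case: ifP => _; rewrite ?mulr1 ?mulr0.
transitivity (\int[mu]_(x in (A : set (borel_config G))) \sum_(n <oo) h n x)%E.
  by apply: eq_integral => x _; exact: kernelE.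
rewrite integral_nneseries//; last first.
  move=> n _ Y mY; have := mh n measurableT Y mY.
  rewrite setTI => /(sub_borel_config exhE).
  exact: measurableI.
rewrite (_ : A `&` B =
    \bigcup_(w : {ffun K -> nat}) ((A `&` B) `&` cylinder w)); last first.
  apply/seteqP; split=> [x ABx|x [w _ []]//].
  by exists [ffun k : K => x (val k)] => //; split=> //; exact: cylinder_res.
rewrite measure_bigcup_esum.
- rewrite esum_countType; last by move=> w; exact: measure_ge0.
  apply: eq_eseriesr => n _; rewrite /h; case: (pickle_inv n) => [w|] /=.
    exact: termE.
  by rewrite integral0.
- by move=> w; apply: measurableI; [exact: measurableI|exact: measurable_cylinder].
- by apply: trivIset_setIl; exact: trivIset_cylinder.
Qed.

End LimitMeasure.

(** Strict growth forces [G] to be infinite: if it were finite, some [E m] would be all of [G] and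
    could not grow. *)
Lemma exhausting_bijective (G : groupType) (E : nat -> {fset G}) :
  exhausting E -> countable [set: G] ->
  exists (i : G -> nat) (j : nat -> G), cancel i j /\ cancel j i.
Proof.
move=> exhE cG.
have infG : infinite_set [set: G].
  move=> finG; have [m FE] := exhausting_fset exhE (fset_set [set: G]).
  case: exhE => _ _ /(_ m)/andP[_ /negP + _]; apply.
  apply/fsubsetP => g _; apply: (fsubsetP FE).
  by rewrite in_fset_set// in_setT.
have /pcard_eqP[f] := eq_card_nat cG infG.
have finj : injective f by move=> x y; apply: (@inj _ _ _ f); rewrite in_setT.
have /choice[j jP] n : exists g, f g = n.
  by have [g _ <-] := @surj _ _ _ _ f n I; exists g.
by exists f, j; split=> [g|n]; [apply: finj; rewrite jP|exact: jP].
Qed.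

Theorem theorem5p11 (R : realType) (G : groupType)
    (countableG : countable [set: G]) (amenableG : amenable R G)
    (phi : config G -> R) (E : nat -> {fset G})
    (exhE : exhausting E) (exp_phi : exp_summable phi)
    (var_phi : summable_variation phi E) :
  [set mu : probability (borel_config G) R |
     act_invariant mu /\ DLR_measure phi E mu] !=set0.
Proof.
have [m [t [cm t0 tight minv dlr_m]]] :=
  exists_limit_content exhE var_phi exp_phi amenableG.
have [i [j [ij ji]]] := exhausting_bijective exhE countableG.
have [mu mu_local] := content_measure cm t0 tight ij ji exhE.
exists mu; split; first exact: (act_invariant_of_local exhE mu_local minv).
(* The kernel itself serves as the version, so the almost sure equality is an identity. *)
move=> K B _ mB; exists (dlr_kernel phi E K B); split; last exact: aeW.
exact: (dlr_kernel_cond_prob exhE var_phi exp_phi mu_local K dlr_m mB).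
Qed.
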